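(* Let $1\le d\le n$ be integers, let $X_1,\ldots,X_n$ be independent random vectors with the standard normal distribution on $\mathbb R^d$, and let $$\mathrm{Zon}\{X_1,\ldots,X_n\}=\{t_1X_1+\ldots+t_nX_n\colon t_1,\ldots,t_n\in[0,1]\}$$ be the Gaussian zonotope, i.e. the Minkowski sum of the segments $[0,X_1],\ldots,[0,X_n]$. Then $$\mathbb E\,\mathrm{Vol}_d(\mathrm{Zon}\{X_1,\ldots,X_n\})=\frac{n!}{2^{d/2}\,(n-d)!\,\Gamma\left(\frac d2+1\right)}.$$
   Context: $\mathrm{Vol}_d$ is $d$-dimensional Lebesgue measure and $\Gamma$ is the Gamma function. *)

(* Defs.v *)
From HB Require Import structures.
From mathcomp Require Import all_boot all_order all_algebra.
From mathcomp Require Import all_classical all_reals all_analysis.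

Set Implicit Arguments.
Unset Strict Implicit.
Unset Printing Implicit Defensive.

Import Order.TTheory GRing.Theory Num.Theory.
Import numFieldNormedType.Exports.

Local Open Scope classical_set_scope.
Local Open Scope ring_scope.

Definition cons_pair {T : Type} {n : nat} (p : T * n.-tuple T) : n.+1.-tuple T :=
  [tuple of p.1 :: p.2].

Definition uncons_pair {T : Type} {n : nat} (t : n.+1.-tuple T) : T * n.-tuple T :=
  (thead t, [tuple of behead t]).

Lemma cons_pairK {T : Type} {n : nat} : cancel (@cons_pair T n) uncons_pair.
Proof.
by move=> [x t]; rewrite /uncons_pair /cons_pair/= theadE; congr pair;
  exact: val_inj.
Qed.

Lemma uncons_pairK {T : Type} {n : nat} : cancel (@uncons_pair T n) cons_pair.
Proof. by move=> t; rewrite [RHS]tuple_eta; exact: val_inj. Qed.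

Section cons_measure.
Context (d : measure_display) (T : measurableType d) (R : realType) (n : nat).

Lemma measurable_cons_pair :
  measurable_fun [set: T * n.-tuple T] (@cons_pair T n).
Proof.
exact: (measurable_cons (f := fst) (g := snd) measurable_fst measurable_snd).
Qed.

Lemma measurable_uncons_pair :
  measurable_fun [set: n.+1.-tuple T] (@uncons_pair T n).
Proof.
apply/measurable_fun_pairP; split.
- exact: (@measurable_tnth _ T n.+1 ord0).
- exact: measurable_behead.
Qed.

Context (m : {sigma_finite_measure set T -> \bar R})
  (m' : {sigma_finite_measure set (n.-tuple T) -> \bar R}).

Definition cons_measure : set (n.+1.-tuple T) -> \bar R :=
  pushforward (m \x m')%E (@cons_pair T n).

Let cons_measure0 : cons_measure set0 = 0%E.
Proof. by rewrite /cons_measure /pushforward preimage_set0 measure0. Qed.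

Let cons_measure_ge0 A : (0 <= cons_measure A)%E.
Proof. exact: (measure_ge0 (m \x m')%E). Qed.

Let cons_measure_sigma_additive : semi_sigma_additive cons_measure.
Proof.
move=> F mF tF mUF; rewrite /cons_measure /pushforward preimage_bigcup.
apply: measure_semi_sigma_additive.
- by move=> k; rewrite -[X in measurable X]setTI; exact: measurable_cons_pair.
- apply/trivIsetP => i j _ _ ij; rewrite -preimage_setI.
  by move/trivIsetP : tF => ->//; rewrite preimage_set0.
- by rewrite -preimage_bigcup -[X in measurable X]setTI;
    exact: measurable_cons_pair.
Qed.

HB.instance Definition _ := isMeasure.Build _ _ _ cons_measure
  cons_measure0 cons_measure_ge0 cons_measure_sigma_additive.

Let cons_measure_sigma_finite : sigma_finite setT cons_measure.
Proof.
have /sigma_finiteP[F [TF ndF Foo]] := sigma_finiteT m.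
have /sigma_finiteP[G [TG ndG Goo]] := sigma_finiteT m'.
exists (fun k => uncons_pair @^-1` (F k `*` G k)).
  rewrite -preimage_bigcup (_ : \bigcup_k _ = setT) ?preimage_setT//.
  rewrite -subTset => -[x y] _.
  have [[i _ Fx] [j _ Gy]] : (\bigcup_k F k) x /\ (\bigcup_k G k) y.
    by rewrite -TF -TG.
  exists (maxn i j) => //; split.
  - by move: x Fx; exact/subsetPset/ndF/leq_maxl.
  - by move: y Gy; exact/subsetPset/ndG/leq_maxr.
move=> k; have [mF Fk] := Foo k; have [mG Gk] := Goo k; split.
  rewrite -[X in measurable X]setTI.
  by apply: measurable_uncons_pair => //; exact: measurableX.
rewrite /cons_measure /pushforward -comp_preimage.
rewrite (_ : _ \o _ = id) ?preimage_id; last exact/funext/cons_pairK.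
by rewrite product_measure1E// lte_mul_pinfty// ge0_fin_numE.
Qed.

HB.instance Definition _ := @Measure_isSigmaFinite.Build _ _ _ cons_measure
  cons_measure_sigma_finite.

End cons_measure.

Section power_measure.
Context (d : measure_display) (T : measurableType d) (R : realType).

Fixpoint power_measure (m : {sigma_finite_measure set T -> \bar R}) (n : nat) :
    {sigma_finite_measure set (n.-tuple T) -> \bar R} :=
  if n isn't k.+1 then \d_([tuple] : 0.-tuple T)
  else cons_measure m (power_measure m k).

(* Boxes are a pi-system, so this characterizes power_measure m n as the n-fold
   product of m. *)
Lemma power_measure_box (m : {sigma_finite_measure set T -> \bar R}) (n : nat)
    (A : 'I_n -> set T) :
  (forall i, measurable (A i)) ->
  power_measure m n [set t | forall i, A i (tnth t i)] = (\prod_(i < n) m (A i))%E.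
Proof.
elim: n A => [|n IH] A mA.
  by rewrite big_ord0 /= diracE mem_set// => -[].
rewrite big_ord_recl -(IH (fun i => A (lift ord0 i)))//=.
have mB : measurable [set t | forall i, A (lift ord0 i) (tnth t i)].
  rewrite (_ : mkset _ = \bigcap_(i in [set: 'I_n])
      ((@tnth n T ^~ i) @^-1` A (lift ord0 i))); last first.
    by apply/seteqP; split => [t /= h i _|t h i]; exact: h.
  apply: fin_bigcap_measurable => [|i _]; first exact: finite_finset.
  by rewrite -[X in measurable X]setTI; exact: measurable_tnth.
rewrite -product_measure1E// /cons_measure /pushforward; congr (_ _).
apply/seteqP; split => [[x t] /= h|[x t] /= [h0 h] i].
- split; first exact: (h ord0).
  by move=> i; have := h (lift ord0 i); rewrite tnthS.
- by have [j ->|->//] := unliftP ord0 i; rewrite tnthS; exact: h.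
Qed.

End power_measure.

(* measurableTypeR R is R with its Borel sigma-algebra, the carrier on which the
   library defines lebesgue_measure and normal_prob; d-tuples over it carry the
   product sigma-algebra, i.e. the Borel sigma-algebra of R^d. *)
Notation vec R d := (d.-tuple (measurableTypeR R)).

Section gaussian_zonotope.
Context (R : realType).

Definition lebesgue_vec (d : nat) :
    {sigma_finite_measure set (vec R d) -> \bar R} :=
  power_measure (@lebesgue_measure R) d.

Definition std_normal_vec (d : nat) :
    {sigma_finite_measure set (vec R d) -> \bar R} :=
  power_measure (normal_prob (0 : R) 1) d.

Definition Gamma (a : R) : R :=
  \int[@lebesgue_measure R]_(x in `]0, +oo[) (x `^ (a - 1) * expR (- x)).

Definition Zon (d n : nat) (x : 'I_n -> vec R d) : set (vec R d) :=
  [set y | exists t : 'I_n -> R, (forall i, 0 <= t i <= 1) /\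
    forall j, tnth y j = \sum_(i < n) t i * (tnth (x i) j : R)].

End gaussian_zonotope.

Definition mutually_independent (dT dS : measure_display)
    (T : measurableType dT) (S : measurableType dS) (R : realType)
    (P : probability T R) (I : finType) (X : I -> {RV P >-> S}) : Prop :=
  forall (J : {set I}) (A : I -> set S), (forall i, measurable (A i)) ->
    P (\bigcap_(i in [set` J]) (X i @^-1` A i)) =
    (\prod_(i in J) P (X i @^-1` A i))%E.

(* Main.v *)
(** Let [Z] be a zonotope in [R^(d+1)] and [x] a vector. Every line
    parallel to [x] meets [Z] in a segment or not at all, so by Fubini
    [Vol_(d+1) (Z + [0, x]) = Vol_(d+1) Z + |x| Vol_d (pi Z)], where [pi] is the
    projection along [x]. Conditioning on one of the Gaussian vectors, and using
    the rotation invariance of the others to move it onto the first axis, the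
    expected volume [E(d, n)] satisfies
    [E(d+1, n+1) = E(d+1, n) + E|X| E(d, n)] with [X] standard normal in
    [R^(d+1)]; hence [E(d, n)] is [binomial(n, d)] times the product of the
    means of [|X|] in dimensions [1, ..., d].

    With [I_k] the integral of [r^k exp (- r^2 / 2)] over the half line, slicing
    the Gaussian density by balls gives [E|X| = d I_d / I_(d+1)] in [R^d], so that
    the product telescopes to [d! / I_(d+1)]; slicing in the variable
    [|x|^2 / 2] instead shows [I_(d+1) = 2^(d/2) Gamma (d/2 + 1)], without any
    change of variables. *)

Require Import Defs.
From mathcomp Require Import all_boot all_order all_algebra.
From mathcomp Require Import all_classical all_reals all_analysis.
From mathcomp Require Import measurable_realfun.
From mathcomp Require Import ring lra.

Set Implicit Arguments.
Unset Strict Implicit.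
Unset Printing Implicit Defensive.

Import Order.TTheory GRing.Theory Num.Theory.
Import numFieldNormedType.Exports.

Local Open Scope classical_set_scope.
Local Open Scope ring_scope.

(** * Integration against powers of a measure *)

(** Rotation invariance is needed only to carry one given vector onto the first axis, and one
    reflection does that. A reflection factors into shears, and a shear is a translation in one
    block of coordinates once the other block is fixed; so invariance of Lebesgue measure reduces to
    Tonelli and to translations and sign changes of the line. The Gaussian law follows, its density
    being a function of the norm.

    The volume of the unit ball is never evaluated. Balls enter through their scaling alone, and
    their common constant is known only as the reciprocal of an integral. Obtaining two such
    integrals for the same constant identifies the half-line moment with the Gamma integral.

    Nonnegative integrals stay in the extended reals, so no integrability has to be checked on the
    way. Identities are therefore written with sums instead of differences, and finiteness is
    recovered at the end from products equal to 1. *)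

Section transfer.
Context d1 d2 (T1 : measurableType d1) (T2 : measurableType d2) (R : realType).
Local Open Scope ereal_scope.

Lemma ge0_integral_transfer (m1 : {measure set T1 -> \bar R})
    (m2 : {measure set T2 -> \bar R}) (phi : T1 -> T2) (f : T2 -> \bar R) :
  measurable_fun setT phi ->
  (forall A, measurable A -> m1 (phi @^-1` A) = m2 A) ->
  measurable_fun setT f -> (forall y, 0 <= f y) ->
  \int[m1]_x f (phi x) = \int[m2]_y f y.
Proof.
move=> mphi m12 mf f0.
have := @ge0_integral_pushforward _ _ T1 T2 R phi mphi m1 setT f measurableT mf
  (fun y _ => f0 y).
rewrite preimage_setT => <-; apply: eq_measure_integral => A mA _.
exact: m12.
Qed.

End transfer.

Section density.
Context d (T : measurableType d) (R : realType).
Variables (mu nu : {measure set T -> \bar R}) (h : T -> R).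
Hypothesis mh : measurable_fun setT h.
Hypothesis h0 : forall x, 0 <= h x.
Hypothesis nuE : forall A, measurable A ->
  nu A = (\int[mu]_(x in A) (h x)%:E)%E.
Local Open Scope ereal_scope.
Import HBNNSimple.

Let density_nnsfun (f : {nnsfun T >-> R}) :
  \int[nu]_x (f x)%:E = \int[mu]_x ((f x)%:E * (h x)%:E).
Proof.
have mh' : measurable_fun setT (EFin \o h) by exact/measurable_EFinP.
under [LHS]eq_integral do rewrite fimfunE -fsumEFin//.
rewrite [LHS]ge0_integral_fsum//; last 2 first.
  - by move=> r; exact/measurable_EFinP/measurableT_comp.
  - by move=> n x _; rewrite EFinM nnfun_muleindic_ge0.
under [RHS]eq_integral.
  move=> x xD; rewrite fimfunE -fsumEFin// muleC ge0_mule_fsumr; last first.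
    by move=> r; rewrite EFinM nnfun_muleindic_ge0.
  over.
rewrite [RHS]ge0_integral_fsum//; last 2 first.
  - move=> r; apply: emeasurable_funM => //.
    by apply/measurable_EFinP; exact: measurableT_comp.
  - move=> n x _; apply: mule_ge0; first by rewrite lee_fin.
    by rewrite EFinM nnfun_muleindic_ge0.
apply: eq_fsbigr => r rf.
have r0 : (0 <= r)%R by move: rf; rewrite inE => -[x _ <-].
have mfr : measurable (f @^-1` [set r]) by exact: measurable_sfunP.
rewrite integralZl_indic_nnsfun// integral_indic// setIT nuE//.
rewrite [in LHS]integral_mkcond -ge0_integralZl//; last 2 first.
  - by apply/(measurable_restrictT _ mfr); exact: measurable_funTS mh'.
  - move=> x _; by apply: erestrict_ge0 => y _; rewrite lee_fin.
apply: eq_integral => x _ /=; rewrite patchE indicE.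
by case: ifPn => _; rewrite ?mulr1 ?mulr0 ?mule0// muleC.
Qed.

(** Simple functions first, then monotone convergence on both sides along the same approximating
    sequence. *)
Lemma ge0_integral_density (f : T -> \bar R) :
  measurable_fun setT f -> (forall x, 0 <= f x) ->
  \int[nu]_x f x = \int[mu]_x (f x * (h x)%:E).
Proof.
move=> mf f0.
pose f_ := nnsfun_approx measurableT mf.
have mh' : measurable_fun setT (EFin \o h) by exact/measurable_EFinP.
transitivity (lim (\int[nu]_x (f_ n x)%:E @[n --> \oo])).
  rewrite -monotone_convergence//=.
  - apply: eq_integral => ? /[!inE] xD; apply/esym/cvg_lim => //=.
    exact: cvg_nnsfun_approx.
  - by move=> n; exact/measurable_EFinP/measurable_funTS.
  - by move=> n ? _; rewrite lee_fin.
  - by move=> ? _ ? ? mn; rewrite lee_fin; exact/lefP/nd_nnsfun_approx.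
transitivity (lim (\int[mu]_x ((f_ n x)%:E * (h x)%:E) @[n --> \oo])).
  by apply: congr_lim; apply/funext => n /=; exact: density_nnsfun.
rewrite -monotone_convergence//=.
- apply: eq_integral => x /[!inE] xD; apply/cvg_lim => //=.
  by apply: cvgeZr => //; exact: cvg_nnsfun_approx.
- move=> n; apply: emeasurable_funM => //.
  exact/measurable_EFinP/measurable_funTS.
- by move=> n ? _; rewrite mule_ge0 ?lee_fin.
- move=> ? _ ? ? mn; rewrite lee_pmul ?lee_fin//.
  exact/lefP/nd_nnsfun_approx.
Qed.

End density.

Section power_measure_integral.
Context d (T : measurableType d) (R : realType).
Local Open Scope ereal_scope.
Implicit Types m : {sigma_finite_measure set T -> \bar R}.

Lemma integral_power_measure0 m (f : 0.-tuple T -> \bar R) :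
  measurable_fun setT f -> \int[power_measure m 0]_x f x = f [tuple].
Proof. by move=> mf; rewrite /= integral_dirac// diracT mul1e. Qed.

Lemma integral_power_measureS m n (f : n.+1.-tuple T -> \bar R) :
  measurable_fun setT f -> (forall x, 0 <= f x) ->
  \int[power_measure m n.+1]_x f x =
  \int[m]_x \int[power_measure m n]_y f (cons_pair (x, y)).
Proof.
move=> mf f0.
have mfc : measurable_fun setT (f \o @cons_pair T n).
  by apply: measurableT_comp => //; exact: measurable_cons_pair.
rewrite -(fubini_tonelli1 _ mfc (fun x => f0 _)).
symmetry; apply: (@ge0_integral_transfer _ _ _ _ _
  (m \x power_measure m n) (power_measure m n.+1) (@cons_pair T n) f) => //.
exact: measurable_cons_pair.
Qed.

Lemma integral_power_measureS' m n (f : n.+1.-tuple T -> \bar R) :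
  measurable_fun setT f -> (forall x, 0 <= f x) ->
  \int[power_measure m n.+1]_x f x =
  \int[power_measure m n]_y \int[m]_x f (cons_pair (x, y)).
Proof.
move=> mf f0; rewrite integral_power_measureS//.
have mfc : measurable_fun setT (f \o @cons_pair T n).
  by apply: measurableT_comp => //; exact: measurable_cons_pair.
exact: (fubini_tonelli _ mfc (fun x => f0 _)).
Qed.

Lemma measurable_cons_pair1 n (x : T) :
  measurable_fun setT (fun y : n.-tuple T => cons_pair (x, y)).
Proof. by apply: measurableT_comp; [exact: measurable_cons_pair|]. Qed.

Lemma measurable_cons_pair2 n (y : n.-tuple T) :
  measurable_fun setT (fun x : T => cons_pair (x, y)).
Proof. by apply: measurableT_comp; [exact: measurable_cons_pair|]. Qed.

End power_measure_integral.

Section tuples.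
Context (T : Type).

Lemma tnth_cons_pair0 n (p : T * n.-tuple T) : tnth (cons_pair p) ord0 = p.1.
Proof. by []. Qed.

Lemma tnth_cons_pairS n (p : T * n.-tuple T) (i : 'I_n) :
  tnth (cons_pair p) (lift ord0 i) = tnth p.2 i.
Proof. by rewrite /cons_pair tnthS. Qed.

Lemma mktupleS n (F : 'I_n.+1 -> T) :
  [tuple F i | i < n.+1] = cons_pair (F ord0, [tuple F (lift ord0 i) | i < n]).
Proof.
apply: eq_from_tnth => i; rewrite tnth_mktuple.
by have [j ->|->] := unliftP ord0 i; rewrite ?tnth_cons_pairS ?tnth_mktuple.
Qed.

End tuples.

Lemma measurable_mktuple d1 d2 (T1 : measurableType d1) (T2 : measurableType d2)
    n (F : 'I_n -> T1 -> T2) :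
  (forall i, measurable_fun setT (F i)) ->
  measurable_fun setT (fun x => [tuple F i x | i < n]).
Proof.
move=> mF; apply/measurable_fun_tnthP => i.
by rewrite (_ : _ \o _ = F i)//; apply/funext => x /=; rewrite tnth_mktuple.
Qed.

Lemma measurable_mktuple_map d1 d2 (T1 : measurableType d1)
    (T2 : measurableType d2) n (F : 'I_n -> T1 -> T2) :
  (forall i, measurable_fun setT (F i)) ->
  measurable_fun setT (fun x : n.-tuple T1 => [tuple F i (tnth x i) | i < n]).
Proof.
move=> mF; apply: (measurable_mktuple (F := fun i x => F i (tnth x i))) => i.
by apply: measurableT_comp => //; exact: measurable_tnth.
Qed.

Section power_measure_map.
Context d1 d2 (T1 : measurableType d1) (T2 : measurableType d2) (R : realType).
Variables (m1 : {sigma_finite_measure set T1 -> \bar R})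
  (m2 : {sigma_finite_measure set T2 -> \bar R}) (c : R).
Hypothesis c0 : 0 <= c.
Local Open Scope ereal_scope.

(** One statement for several coordinatewise maps: translations ([phi] depends on [i]), scalings
    ([c] differs from 1), reflection of every vector, and projections ([T1] differs from [T2]). The
    hypothesis on [phi] speaks of integrals because the induction applies it to the partial integral
    [g]. *)
Lemma integral_power_measure_map n (phi : 'I_n -> T1 -> T2)
    (f : n.-tuple T2 -> \bar R) :
  (forall i, measurable_fun setT (phi i)) ->
  (forall i (g : T2 -> \bar R), measurable_fun setT g -> (forall y, 0 <= g y) ->
    \int[m1]_x g (phi i x) = c%:E * \int[m2]_y g y) ->
  measurable_fun setT f -> (forall x, 0 <= f x) ->
  \int[power_measure m1 n]_x f [tuple phi i (tnth x i) | i < n] =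
  (c ^+ n)%:E * \int[power_measure m2 n]_y f y.
Proof.
elim: n phi f => [|n IH] phi f mphi phiE mf f0.
  rewrite expr0 mul1e !integral_power_measure0//.
    by congr f; exact: tuple0.
  by apply: measurableT_comp => //; exact: measurable_mktuple_map.
rewrite integral_power_measureS//; last first.
  by apply: measurableT_comp => //; exact: measurable_mktuple_map.
pose g y := \int[power_measure m2 n]_z f (cons_pair (y, z)).
have mfc : measurable_fun setT (f \o @cons_pair T2 n).
  by apply: measurableT_comp => //; exact: measurable_cons_pair.
have mg : measurable_fun setT g.
  exact: (measurable_fun_fubini_tonelli_F _ mfc (fun x => f0 _)).
have g0 y : 0 <= g y by apply: integral_ge0.
transitivity (\int[m1]_x ((c ^+ n)%:E * g (phi ord0 x))).
  apply: eq_integral => x _.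
  have mfx : measurable_fun setT (fun z => f (cons_pair (phi ord0 x, z))).
    by apply: measurableT_comp => //; exact: measurable_cons_pair1.
  rewrite -(IH (fun i => phi (lift ord0 i)) _ (fun i => mphi _) (fun i => @phiE _) mfx)//.
  apply: eq_integral => y _; rewrite mktupleS; congr (f (cons_pair (_, _))).
  by apply: eq_mktuple => i; rewrite tnth_cons_pairS.
have mgp : measurable_fun setT (fun x => g (phi ord0 x)) by exact: measurableT_comp.
rewrite (ge0_integralZl m1 measurableT mgp)//; last by rewrite lee_fin exprn_ge0.
rewrite phiE// muleA -EFinM -exprSr; congr (_ * _).
by rewrite -integral_power_measureS.
Qed.

End power_measure_map.

Section power_measure_prob.
Context d (T : measurableType d) (R : realType).
Local Open Scope ereal_scope.

Lemma power_measureT (m : {sigma_finite_measure set T -> \bar R}) n :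
  m setT = 1 -> power_measure m n setT = 1.
Proof.
move=> m1; have := power_measure_box m (fun i : 'I_n => measurableT).
rewrite big1// => <-; congr (power_measure m n _).
by apply/seteqP; split.
Qed.

(** The head is integrated out with total mass 1: marginals of a Gaussian vector are Gaussian. *)
Lemma integral_power_measure_behead (m : {sigma_finite_measure set T -> \bar R})
    n (f : n.-tuple T -> \bar R) :
  m setT = 1 -> measurable_fun setT f -> (forall x, 0 <= f x) ->
  \int[power_measure m n.+1]_x f (uncons_pair x).2 =
  \int[power_measure m n]_y f y.
Proof.
move=> m1 mf f0; rewrite integral_power_measureS//; last first.
  apply: measurableT_comp => //.
  by apply: measurableT_comp => //; exact: measurable_uncons_pair.
under eq_integral do under eq_integral do rewrite cons_pairK/=.
by rewrite integral_cst//= m1 mule1.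
Qed.

End power_measure_prob.

Section lebesgue_vec.
Context (R : realType).
Local Open Scope ereal_scope.
Notation mu := (@lebesgue_measure R).

Lemma ge0_integral_lebesgue_translate (a : R) (f : measurableTypeR R -> \bar R) :
  measurable_fun setT f -> (forall x, 0 <= f x) ->
  \int[mu]_x f (x + a)%R = \int[mu]_x f x.
Proof.
move=> mf f0.
have ma : measurable_fun setT (fun x : measurableTypeR R => (x + a)%R : measurableTypeR R).
  exact: measurable_funD.
apply: (@ge0_integral_transfer _ _ _ _ _ mu mu
  (fun x : measurableTypeR R => (x + a)%R : measurableTypeR R)) => //.
move=> A mA; apply/esym.
pose nu := pushforward mu (fun x : measurableTypeR R => (x + a)%R : measurableTypeR R).
apply: (@lebesgue_measure_unique R nu) => // _ [[b c] _ <-].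
transitivity (mu `](b - a)%R, (c - a)%R]%classic); last first.
  congr (mu _); apply/seteqP; split => x /=.
    by rewrite !in_itv/= ltrBlDr lerBrDr.
  by rewrite !in_itv/= ltrBlDr lerBrDr.
rewrite !lebesgue_measure_itv/= !lte_fin ltrD2r.
by case: ifPn => // _; rewrite -!EFinD; congr EFin; ring.
Qed.

Lemma ge0_integral_lebesgue_scale (r : R) (f : measurableTypeR R -> \bar R) :
  (0 < r)%R -> measurable_fun setT f -> (forall x, 0 <= f x) ->
  \int[mu]_x f (x / r)%R = r%:E * \int[mu]_x f x.
Proof.
move=> r0 mf f0.
pose s : measurableTypeR R -> measurableTypeR R := fun x => (x / r)%R.
have ms : measurable_fun setT s by exact: measurable_funM.
pose k : {nonneg R} := NngNum (ltW r0).
rewrite -(ge0_integral_mscale _ _ k)//.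
apply: (@ge0_integral_transfer _ _ _ _ _ mu (mscale k mu) s) => //.
move=> A mA.
(* [k'] is [1 / r]. The push-forward must be divided by [r] before the uniqueness of Lebesgue
   measure applies to it. *)
pose k' : {nonneg R} := NngNum (ltW (divr_gt0 ltr01 r0)).
transitivity (r%:E * (k'%:num%:E * mu (s @^-1` A))).
  by rewrite muleA -EFinM /k' /= div1r divff ?gt_eqF// mul1e.
congr (_ * _); apply/esym; apply: (@lebesgue_measure_unique R (mscale k' (pushforward mu s))) => //.
move=> _ [[b c] _ <-]; rewrite /mscale.
transitivity (k'%:num%:E * mu `](r * b)%R, (r * c)%R]%classic); last first.
  congr (_ * _).
  congr (mu _); apply/seteqP; split => x /=; rewrite !in_itv/= /s.
    by rewrite ltr_pdivlMr// ler_pdivrMr// ![(r * _)%R]mulrC.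
  by rewrite ltr_pdivlMr// ler_pdivrMr// ![(r * _)%R]mulrC.
rewrite !lebesgue_measure_itv/= !lte_fin ltr_pM2l//.
case: ifPn => _; rewrite ?mule0// -!EFinD -EFinM; congr EFin.
by field; rewrite gt_eqF.
Qed.

Lemma integral_lebesgue_vec_translate d (a : 'I_d -> R) (f : vec R d -> \bar R) :
  measurable_fun setT f -> (forall x, 0 <= f x) ->
  \int[lebesgue_vec R d]_x f [tuple tnth x i + a i | i < d]%R =
  \int[lebesgue_vec R d]_x f x.
Proof.
move=> mf f0.
rewrite (@integral_power_measure_map _ _ _ _ R mu mu 1 _ d
  (fun i (x : measurableTypeR R) => (x + a i)%R : measurableTypeR R))//.
- by rewrite expr1n mul1e.
- by move=> i; exact: measurable_funD.
- by move=> i g mg g0; rewrite mul1e ge0_integral_lebesgue_translate.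
Qed.

Lemma integral_lebesgue_vec_scale d (r : R) (f : vec R d -> \bar R) :
  (0 < r)%R -> measurable_fun setT f -> (forall x, 0 <= f x) ->
  \int[lebesgue_vec R d]_x f [tuple tnth x i / r | i < d]%R =
  (r ^+ d)%:E * \int[lebesgue_vec R d]_x f x.
Proof.
move=> r0 mf f0.
rewrite -(@integral_power_measure_map _ _ _ _ R mu mu r (ltW r0) d
  (fun i (x : measurableTypeR R) => (x / r)%R : measurableTypeR R))//.
- by move=> i; exact: measurable_funM.
- by move=> i g mg g0; rewrite ge0_integral_lebesgue_scale.
Qed.

End lebesgue_vec.

(** * Gaussian density and reflections *)

Section dot_product.
Context (R : realType).

Definition dotv d (x y : vec R d) : R :=
  \sum_(j < d) (tnth x j : R) * (tnth y j : R).

Definition enorm d (x : vec R d) : R := Num.sqrt (dotv x x).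

Lemma dotv_ge0 d (x : vec R d) : 0 <= dotv x x.
Proof. by apply: sumr_ge0 => j _; rewrite -expr2 sqr_ge0. Qed.

Lemma enorm_ge0 d (x : vec R d) : 0 <= enorm x. Proof. exact: sqrtr_ge0. Qed.

Lemma sqr_enorm d (x : vec R d) : enorm x ^+ 2 = dotv x x.
Proof. by rewrite sqr_sqrtr ?dotv_ge0. Qed.

Lemma dotvC d (x y : vec R d) : dotv x y = dotv y x.
Proof. by apply: eq_bigr => j _; rewrite mulrC. Qed.

Lemma dotv_cons d (p q : measurableTypeR R * vec R d) :
  dotv (cons_pair p) (cons_pair q) = (p.1 : R) * (q.1 : R) + dotv p.2 q.2.
Proof.
rewrite /dotv big_ord_recl !tnth_cons_pair0; congr (_ + _).
by apply: eq_bigr => j _; rewrite !tnth_cons_pairS.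
Qed.

Lemma measurable_dotv d0 (T : measurableType d0) d (f g : T -> vec R d) :
  measurable_fun setT f -> measurable_fun setT g ->
  measurable_fun setT (fun x => dotv (f x) (g x)).
Proof.
move=> mf mg; apply: measurable_sum => j; apply: measurable_funM.
- by apply: (measurableT_comp (measurable_tnth j)).
- by apply: (measurableT_comp (measurable_tnth j)).
Qed.

Lemma measurable_enorm d : measurable_fun setT (@enorm d).
Proof.
apply: (measurableT_comp (f := @Num.sqrt R)).
  by apply: continuous_measurable_fun; exact: sqrt_continuous.
exact: measurable_dotv.
Qed.

End dot_product.

Section normal_vec_density.
Context (R : realType).
Local Open Scope ereal_scope.

(** The product of the one-dimensional densities, written through the norm to make its invariance
    under reflections immediate. *)
Definition normal_vec_pdf d (x : vec R d) : R :=
  (normal_peak 1 ^+ d * expR (- (enorm x ^+ 2 / 2)))%R.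

Lemma normal_vec_pdf_ge0 d (x : vec R d) : (0 <= normal_vec_pdf x)%R.
Proof. by rewrite mulr_ge0 ?expR_ge0// exprn_ge0// normal_peak_ge0. Qed.

Lemma measurable_normal_vec_pdf d : measurable_fun setT (@normal_vec_pdf d).
Proof.
apply: measurable_funM => //; apply: measurableT_comp => //.
apply: measurableT_comp => //; apply: measurable_funM => //.
by apply: measurable_funX; exact: measurable_enorm.
Qed.

Lemma normal_vec_pdf_cons d (p : measurableTypeR R * vec R d) :
  normal_vec_pdf (cons_pair p) = (normal_vec_pdf p.2 * normal_pdf 0 1 p.1)%R.
Proof.
rewrite /normal_vec_pdf normal_pdfE ?oner_eq0// /normal_fun !sqr_enorm dotv_cons.
rewrite exprS subr0 expr1n mulr2n mulrDl opprD expRD -[(1 + 1)%R]/2%R mulNr -expr2.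
ring.
Qed.

Lemma integral_std_normal_vec d (f : vec R d -> \bar R) :
  measurable_fun setT f -> (forall x, 0 <= f x) ->
  \int[std_normal_vec R d]_x f x =
  \int[lebesgue_vec R d]_x (f x * (normal_vec_pdf x)%:E).
Proof.
elim: d f => [|d IH] f mf f0.
  rewrite !integral_power_measure0//.
    by rewrite /normal_vec_pdf expr0 mul1r sqr_enorm /dotv big_ord0 mul0r oppr0 expR0 mule1.
  apply: emeasurable_funM => //; apply/measurable_EFinP.
  exact: measurable_normal_vec_pdf.
have mfpdf : measurable_fun setT (fun x => f x * (normal_vec_pdf x)%:E).
  apply: emeasurable_funM => //; apply/measurable_EFinP.
  exact: measurable_normal_vec_pdf.
rewrite !integral_power_measureS//; last first.
  by move=> x; rewrite mule_ge0// lee_fin normal_vec_pdf_ge0.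
have mfc : measurable_fun setT (fun p : measurableTypeR R * vec R d =>
    f (cons_pair p) * (normal_vec_pdf p.2)%:E).
  apply: emeasurable_funM.
    by apply: measurableT_comp => //; exact: measurable_cons_pair.
  apply/measurable_EFinP; apply: measurableT_comp => //.
  exact: measurable_normal_vec_pdf.
have fc0 p : 0 <= f (cons_pair p) * (normal_vec_pdf p.2)%:E.
  by rewrite mule_ge0// lee_fin normal_vec_pdf_ge0.
pose g (x : measurableTypeR R) :=
  \int[lebesgue_vec R d]_y (f (cons_pair (x, y)) * (normal_vec_pdf y)%:E).
have mg : measurable_fun setT g.
  exact: (measurable_fun_fubini_tonelli_F _ mfc fc0).
have g0 x : 0 <= g x by apply: integral_ge0 => y _; exact: (fc0 (x, y)).
transitivity (\int[normal_prob 0 1]_x g x).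
  apply: eq_integral => x _; apply: (IH (fun y => f (cons_pair (x, y)))) => //.
  by apply: measurableT_comp => //; exact: measurable_cons_pair1.
rewrite (@ge0_integral_density _ _ R (@lebesgue_measure R) (normal_prob 0 1)
  (normal_pdf 0 1) (measurable_normal_pdf 0 1) (normal_pdf_ge0 0 1)
  (fun _ _ => erefl) g mg g0).
apply: eq_integral => x _; rewrite -ge0_integralZr//.
- by apply: eq_integral => y _; rewrite normal_vec_pdf_cons /= -muleA -EFinM.
- exact: (measurable_fun_pair2 x mfc).
- by rewrite lee_fin normal_pdf_ge0.
Qed.

End normal_vec_density.

(** * Reflections preserve Lebesgue measure and the Gaussian law *)

Section householder.
Context (R : realType).
Local Open Scope ereal_scope.
Notation mu := (@lebesgue_measure R).

Definition hshear d (w : vec R d) (z : vec R d.+1) : vec R d.+1 :=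
  let p := uncons_pair z in cons_pair (((p.1 : R) + dotv w p.2)%R, p.2).

(** The sign change is forced: shears have determinant 1 and a reflection has determinant -1, so one
    factor must reverse orientation. *)
Definition vshear d (b : vec R d) (z : vec R d.+1) : vec R d.+1 :=
  let p := uncons_pair z in
  cons_pair ((- (p.1 : R))%R, [tuple ((tnth p.2 j : R) + p.1 * tnth b j)%R | j < d]).

Lemma measurable_hshear d (w : vec R d) : measurable_fun setT (hshear w).
Proof.
have m2 : measurable_fun setT (fun z : vec R d.+1 => (uncons_pair z).2).
  by apply: measurableT_comp => //; exact: measurable_uncons_pair.
apply: (measurable_cons (f := fun z => (((uncons_pair z).1 : R) + dotv w (uncons_pair z).2)%R)
  (g := fun z => (uncons_pair z).2)) => //.
apply: measurable_funD; last exact: measurable_dotv.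
by apply: measurableT_comp => //; exact: measurable_uncons_pair.
Qed.

Lemma measurable_vshear d (b : vec R d) : measurable_fun setT (vshear b).
Proof.
have m1 : measurable_fun setT (fun z : vec R d.+1 => (uncons_pair z).1).
  by apply: measurableT_comp => //; exact: measurable_uncons_pair.
have m2 : measurable_fun setT (fun z : vec R d.+1 => (uncons_pair z).2).
  by apply: measurableT_comp => //; exact: measurable_uncons_pair.
apply: (measurable_cons (f := fun z => (- ((uncons_pair z).1 : R))%R)
  (g := fun z => [tuple ((tnth (uncons_pair z).2 j : R) +
     (uncons_pair z).1 * tnth b j)%R | j < d])).
  by apply: measurableT_comp => //.
apply: (measurable_mktuple (F := fun j z => ((tnth (uncons_pair z).2 j : R) +
     (uncons_pair z).1 * tnth b j)%R)) => j.
apply: measurable_funD; last by apply: measurable_funM.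
by apply: (measurableT_comp (measurable_tnth j)).
Qed.

(** With the tail fixed and the head integrated innermost, the shear is a translation of the
    line. *)
Lemma integral_lebesgue_vec_hshear d (w : vec R d) (f : vec R d.+1 -> \bar R) :
  measurable_fun setT f -> (forall x, 0 <= f x) ->
  \int[lebesgue_vec R d.+1]_x f (hshear w x) = \int[lebesgue_vec R d.+1]_x f x.
Proof.
move=> mf f0.
rewrite [LHS]integral_power_measureS'//; last first.
  by apply: measurableT_comp => //; exact: measurable_hshear.
rewrite [RHS]integral_power_measureS'//; apply: eq_integral => y _.
rewrite -[RHS](ge0_integral_lebesgue_translate (dotv w y)) //.
  by apply: eq_integral => x _; rewrite /hshear cons_pairK.
by apply: measurableT_comp => //; exact: measurable_cons_pair2.
Qed.

(** With the head fixed and the tail integrated innermost, the map is a translation of the tail; the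
    remaining sign change of the head preserves Lebesgue measure on the line. *)
Lemma integral_lebesgue_vec_vshear d (b : vec R d) (f : vec R d.+1 -> \bar R) :
  measurable_fun setT f -> (forall x, 0 <= f x) ->
  \int[lebesgue_vec R d.+1]_x f (vshear b x) = \int[lebesgue_vec R d.+1]_x f x.
Proof.
move=> mf f0.
rewrite [LHS]integral_power_measureS//; last first.
  by apply: measurableT_comp => //; exact: measurable_vshear.
rewrite [RHS]integral_power_measureS//.
have mfc : measurable_fun setT (f \o @cons_pair (measurableTypeR R) d).
  by apply: measurableT_comp => //; exact: measurable_cons_pair.
rewrite -[RHS](@ge0_integral_transfer _ _ _ _ _ mu mu
  (-%R : measurableTypeR R -> measurableTypeR R)) //.
- apply: eq_integral => x _.
  rewrite -[RHS](integral_lebesgue_vec_translate (fun j => x * tnth b j)%R) //.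
    by apply: eq_integral => y _; rewrite /vshear cons_pairK.
  by apply: measurableT_comp => //; exact: measurable_cons_pair1.
- exact: lebesgue_measureN.
- exact: (measurable_fun_fubini_tonelli_F _ mfc (fun x => f0 _)).
- by move=> x; exact: integral_ge0.
Qed.

(** The reflection with normal [u] as soon as [k * dotv u u = 2]. Keeping [k] as a parameter avoids
    a division by the squared norm. *)
Definition householder d (u : vec R d) (k : R) (x : vec R d) : vec R d :=
  [tuple ((tnth x j : R) - k * dotv u x * tnth u j)%R | j < d].

Lemma measurable_householder d (u : vec R d) k : measurable_fun setT (householder u k).
Proof.
apply: (measurable_mktuple (F := fun j (x : vec R d) =>
  ((tnth x j : R) - k * dotv u x * tnth u j)%R)) => j /=.
apply: measurable_funB; first exact: measurable_tnth.
apply: measurable_funM => //; apply: measurable_funM => //.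
exact: measurable_dotv.
Qed.

Lemma dotv_householder d (u x y : vec R d) k :
  dotv (householder u k x) y = (dotv x y - k * dotv u x * dotv u y)%R.
Proof.
rewrite /dotv mulr_sumr -sumrB; apply: eq_bigr => j _.
by rewrite tnth_mktuple /dotv; ring.
Qed.

Lemma enorm_householder d (u x : vec R d) k : (k * dotv u u = 2)%R ->
  enorm (householder u k x) = enorm x.
Proof.
move=> ku; congr Num.sqrt.
rewrite dotv_householder !(dotvC _ (householder _ _ _)) !dotv_householder.
rewrite (dotvC x u).
transitivity (dotv x x - (2 - k * dotv u u) * k * dotv u x ^+ 2)%R.
  by ring.
by rewrite ku subrr !mul0r subr0.
Qed.

Lemma householderK d (u : vec R d) k : (k * dotv u u = 2)%R ->
  involutive (householder u k).
Proof.
move=> ku x; apply: eq_from_tnth => j.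
rewrite !tnth_mktuple (dotvC u (householder _ _ _)) dotv_householder (dotvC x).
transitivity ((tnth x j : R) - (2 - k * dotv u u) * k * dotv u x * tnth u j)%R.
  by ring.
by rewrite ku subrr !mul0r subr0.
Qed.

(* A reflection whose normal [u = (a, v)] has [a != 0] is the composite of the
   shear [t += <v, y> / a], the map [(t, y) -> (- t, y - k a t v)] and the shear
   [t -= <v, y> / a]. *)
Lemma householder_shears d (a : R) (v : vec R d) k x :
  (a != 0)%R -> (k * dotv (cons_pair (a, v)) (cons_pair (a, v)) = 2)%R ->
  householder (cons_pair (a, v)) k x =
  hshear [tuple (- (tnth v j : R) / a)%R | j < d]
    (vshear [tuple (- k * a * tnth v j)%R | j < d]
      (hshear [tuple ((tnth v j : R) / a)%R | j < d] x)).
Proof.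
move=> a0 ku; rewrite -(uncons_pairK x); case: (uncons_pair x) => t y {x}.
set w := [tuple ((tnth v j : R) / a)%R | j < d].
set w' := [tuple (- (tnth v j : R) / a)%R | j < d].
set b := [tuple _ | j < d].
have dw : dotv w y = (dotv v y / a)%R.
  rewrite /dotv mulr_suml; apply: eq_bigr => j _; rewrite tnth_mktuple.
  by rewrite mulrAC.
(* [s] is the head after the innermost shear, and [a * s] is the inner product of the normal with
   [x]. *)
pose s : R := (t + dotv v y / a)%R.
have dw' : dotv w' [tuple ((tnth y j : R) + s * tnth b j)%R | j < d] =
    (- (dotv v y / a) + k * s * dotv v v)%R.
  rewrite /dotv mulr_suml -sumrN mulr_sumr -big_split/=; apply: eq_bigr => j _.
  by rewrite !tnth_mktuple; field.
(* In this form the head [- s - <v, y> / a + k s |v|^2] collapses to [t - k a (a s)], as in the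
   reflection. *)
have {}ku : (k * dotv v v = 2 - k * a ^+ 2)%R.
  by apply/eqP; rewrite eq_sym subr_eq -ku dotv_cons/=; apply/eqP; ring.
rewrite /hshear /vshear !cons_pairK/= dw -/s dw'.
rewrite /householder mktupleS !dotv_cons; congr (cons_pair (_, _)).
  rewrite !tnth_cons_pair0 [(k * s * _)%R]mulrAC ku /s /=; field.
  exact: a0.
apply: eq_mktuple => j; rewrite !tnth_cons_pairS tnth_mktuple /s /=; field.
exact: a0.
Qed.

Lemma integral_lebesgue_vec_householder d (a : R) (v : vec R d) k
    (f : vec R d.+1 -> \bar R) :
  (a != 0)%R -> (k * dotv (cons_pair (a, v)) (cons_pair (a, v)) = 2)%R ->
  measurable_fun setT f -> (forall x, 0 <= f x) ->
  \int[lebesgue_vec R d.+1]_x f (householder (cons_pair (a, v)) k x) =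
  \int[lebesgue_vec R d.+1]_x f x.
Proof.
move=> a0 ku mf f0.
under eq_integral do rewrite (householder_shears _ a0 ku).
set h' := hshear _; set s := vshear _; set h := hshear _.
have mf1 : measurable_fun setT (f \o h').
  by apply: measurableT_comp => //; exact: measurable_hshear.
have mf2 : measurable_fun setT (f \o h' \o s).
  by apply: measurableT_comp => //; exact: measurable_vshear.
rewrite (integral_lebesgue_vec_hshear _ mf2 (fun _ => f0 _)).
rewrite (integral_lebesgue_vec_vshear _ mf1 (fun _ => f0 _)).
exact: integral_lebesgue_vec_hshear.
Qed.

Lemma integral_std_normal_vec_householder d (a : R) (v : vec R d) k
    (f : vec R d.+1 -> \bar R) :
  (a != 0)%R -> (k * dotv (cons_pair (a, v)) (cons_pair (a, v)) = 2)%R ->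
  measurable_fun setT f -> (forall x, 0 <= f x) ->
  \int[std_normal_vec R d.+1]_x f (householder (cons_pair (a, v)) k x) =
  \int[std_normal_vec R d.+1]_x f x.
Proof.
move=> a0 ku mf f0.
rewrite !integral_std_normal_vec//; last first.
  by apply: measurableT_comp => //; exact: measurable_householder.
rewrite -[RHS](integral_lebesgue_vec_householder a0 ku).
- apply: eq_integral => x _.
  by rewrite /normal_vec_pdf (enorm_householder _ ku).
- apply: emeasurable_funM => //; apply/measurable_EFinP.
  exact: measurable_normal_vec_pdf.
- by move=> x; rewrite mule_ge0// lee_fin normal_vec_pdf_ge0.
Qed.

End householder.

(** * Zonotopes *)

Section zonotope_measurable.
Context (R : realType).

(** Squared distance from [p.2] to the zonotope point with parameters [t]. The parameters form a row
    vector so that the topology of ['rV] is available: the cube is compact there. *)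
Definition zon_dist d n (t : 'rV[R]_n) (p : n.-tuple (vec R d) * vec R d) : R :=
  \sum_(j < d) ((tnth p.2 j : R) - \sum_(i < n) t ord0 i * (tnth (tnth p.1 i) j : R)) ^+ 2.

Lemma zon_dist_ge0 d n t (p : n.-tuple (vec R d) * vec R d) : 0 <= zon_dist t p.
Proof. by apply: sumr_ge0 => j _; rewrite sqr_ge0. Qed.

Lemma ZonE d n (p : n.-tuple (vec R d) * vec R d) :
  Zon (tnth p.1) p.2 <->
  exists t : 'rV[R]_n, (forall i, 0 <= t ord0 i <= 1) /\ zon_dist t p = 0.
Proof.
split=> [[t [t01 yE]]|[t [t01 /eqP]]].
  exists (\row_i t i); split=> [i|]; first by rewrite mxE.
  rewrite /zon_dist big1// => j _; rewrite yE.
  under [X in _ - X]eq_bigr do rewrite mxE.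
  by rewrite subrr expr0n.
rewrite psumr_eq0 => [/allP h|j _]; last by rewrite sqr_ge0.
exists (fun i => t ord0 i); split=> // j.
have := h j (mem_index_enum _); rewrite /= sqrf_eq0 subr_eq0 => /eqP; exact.
Qed.

(** Stated for an arbitrary filter, to serve both sequences of grid points and neighbourhoods in the
    cube. *)
Lemma cvg_zon_dist d n (F : set_system 'rV[R]_n) {FF : Filter F} (t0 : 'rV[R]_n)
    (p : n.-tuple (vec R d) * vec R d) :
  F --> t0 -> zon_dist t p @[t --> F] --> zon_dist t0 p.
Proof.
move=> Ft.
have cadd : continuous (fun x : R * R => x.1 + x.2) 
    by move=> x; apply: (@cvgD _ R^o); [exact: cvg_fst|exact: cvg_snd].
apply: (cvg_big cadd) => j _.
apply: (@cvg_comp _ _ _ _ (fun x : R => x ^+ 2)); last exact: sqr_continuous.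
apply: (@cvgB _ R^o); first exact: cvg_cst.
apply: (cvg_big cadd) => i _.
apply: cvgM; last exact: cvg_cst.
exact: (@cvg_comp _ _ _ id (fun t : 'rV[R]_n => t ord0 i) _ _ _ Ft
  (@coord_continuous R 1 n ord0 i t0)).
Qed.

Lemma measurable_zon_dist d n (t : 'rV[R]_n) :
  measurable_fun [set: n.-tuple (vec R d) * vec R d] (zon_dist t).
Proof.
apply: measurable_sum => j; apply: measurable_funX; apply: measurable_funB.
  exact: (measurableT_comp (measurable_tnth j) measurable_snd).
apply: measurable_sum => i; apply: measurable_funM => //.
apply: (measurableT_comp (measurable_tnth j)).
exact: (measurableT_comp (measurable_tnth i) measurable_fst).
Qed.

(** The entries of [m] run from 0 to [K.+1], so the grid of mesh [1 / K.+1] contains both ends of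
    the unit interval. *)
Definition grid_point n (K : nat) (m : {ffun 'I_n -> 'I_K.+2}) : 'rV[R]_n :=
  \row_i ((m i)%:R / K.+1%:R).

Lemma grid_point01 n K (m : {ffun 'I_n -> 'I_K.+2}) i :
  0 <= grid_point m ord0 i <= 1.
Proof.
rewrite mxE divr_ge0 ?ler0n//= ler_pdivrMr ?ltr0n// mul1r ler_nat.
by rewrite -ltnS ltn_ord.
Qed.

Lemma grid_point_dense n (t : 'rV[R]_n) : (forall i, 0 <= t ord0 i <= 1) ->
  exists m : forall K, {ffun 'I_n -> 'I_K.+2},
    grid_point (m K) @[K --> \oo] --> t.
Proof.
move=> t01.
pose N (K : nat) i := Num.truncn (t ord0 i * K.+1%:R).
have NK K i : (N K i < K.+2)%N.
  rewrite ltnS -(ler_nat R); have [t0 t1] := andP (t01 i).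
  apply: le_trans (_ : t ord0 i * K.+1%:R <= _).
    by rewrite truncn_le mulr_ge0.
  by rewrite ler_piMl.
exists (fun K => [ffun i => Ordinal (NK K i)]).
apply/cvg_ballP => e e0.
have := near_infty_natSinv_lt (PosNum e0).
apply: filterS => K Ke; split => // k i.
rewrite (ord1 k) !mxE ffunE /ball/= (le_lt_trans _ Ke)//=.
have [t0 t1] := andP (t01 i).
have /andP[Nt tN] : (N K i)%:R <= t ord0 i * K.+1%:R < (N K i).+1%:R.
  by apply: truncn_itv; rewrite mulr_ge0.
have K0 : 0 < K.+1%:R :> R by [].
rewrite ger0_norm; last by rewrite subr_ge0 ler_pdivrMr.
rewrite lerBlDr -(ler_pM2r K0) mulrDl divfK ?gt_eqF// mulVf ?gt_eqF//.
by rewrite addrC natr1 ltW.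
Qed.

(* Compactness of the parameter cube turns the condition on real parameters
   into a countable one. *)
Lemma measurable_Zon d n :
  measurable [set p : n.-tuple (vec R d) * vec R d | Zon (tnth p.1) p.2].
Proof.
rewrite (_ : mkset _ = \bigcap_k \bigcup_K
   \bigcup_(m in [set: {ffun 'I_n -> 'I_K.+2}])
   (zon_dist (grid_point m) @^-1` `]-oo, k.+1%:R^-1[)); last first.
  apply/seteqP; split=> p /=.
    move=> /ZonE[t [t01 tp]] k _.
    have [m mt] := grid_point_dense t01.
    have {}mt : zon_dist (grid_point (m K)) p @[K --> \oo] --> (0 : R).
      by rewrite -tp; apply: (@cvg_zon_dist d n (grid_point (m K) @[K --> \oo])).
    have [|K _ /(_ K (leqnn K)) zK] := cvgr_lt _ mt k.+1%:R^-1.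
      by rewrite invr_gt0.
    by exists K => //; exists (m K) => //=; rewrite in_itv.
  move=> pk; apply/ZonE.
  pose A := [set v : 'rV[R]_n | forall i, `[0, 1]%classic (v ord0 i)].
  have cA : compact A.
    by apply: (@rV_compact R n (fun=> `[0, 1]%classic)) => i; exact: segment_compact.
  have gA K (m : {ffun 'I_n -> 'I_K.+2}) : A (grid_point m).
    by move=> i; rewrite /= in_itv/=; exact: grid_point01.
  have [K _ [m _ _]] := pk 0%N I.
  (* The minimum over the cube is attained and lies below every [1 / k.+1], because some grid point
     does; hence it is 0. *)
  have [||t] := compact_EVT_min (A := A) (f := fun t => zon_dist t p) _ cA.
  - by exists (grid_point m); exact: gA.
  - apply: continuous_subspaceT => t.
    by apply: (@cvg_zon_dist d n (nbhs t)); apply: cvg_id.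
  rewrite inE => At tmin; exists t; split.
    by move=> i; have := At i; rewrite /= in_itv.
  apply/eqP; rewrite eq_le zon_dist_ge0 andbT; apply/ler_addgt0Pr => e e0.
  rewrite add0r.
  have [k _ /(_ k (leqnn k)) /ltW ke] := near_infty_natSinv_lt (PosNum e0).
  apply: le_trans ke.
  have [K' _ [m' _ /=]] := pk k I; rewrite in_itv/= => /ltW; apply: le_trans.
  by apply: tmin; rewrite inE; exact: gA.
apply: bigcapT_measurable => k; apply: bigcupT_measurable => K.
apply: fin_bigcup_measurable => [|m _]; first exact: finite_finset.
by rewrite -[X in measurable X]setTI; apply: measurable_zon_dist.
Qed.

End zonotope_measurable.

Lemma tnth_uncons_pair2 (T : Type) n (x : n.+1.-tuple T) (j : 'I_n) :
  tnth (uncons_pair x).2 j = tnth x (lift ord0 j).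
Proof. by rewrite -[in RHS](uncons_pairK x) tnth_cons_pairS. Qed.

(** * Volume gained by adding a segment along the first axis *)

Section lebesgue_measure_interval.
Context (R : realType).
Notation mu := (@lebesgue_measure R).

Lemma lebesgue_measure_bounded_interval (S : set R) :
  is_interval S -> S !=set0 -> has_lbound S -> has_ubound S ->
  mu S = (sup S - inf S)%:E.
Proof.
move=> iS S0 lS uS; have [s Ss] := S0.
have le_is : inf S <= sup S.
  by apply: (le_trans (ge_inf lS Ss)); exact: ub_le_sup.
rewrite [in LHS]((is_intervalP S).1 iS).
rewrite lebesgue_measure_itv /Rhull (asboolT lS) (asboolT uS) /= lte_fin -EFinD.
case: ltP => // ge_is; apply/esym; congr EFin; apply/eqP.
by rewrite subr_eq0 eq_le le_is ge_is.
Qed.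

Lemma lebesgue_measure_interval_sum (S : set R) (h : R) : 0 <= h ->
  is_interval S -> S !=set0 -> has_lbound S -> has_ubound S ->
  mu [set a + b | a in S & b in `[0, h]%classic] = (mu S + h%:E)%E.
Proof.
move=> h0 iS S0 lS uS.
have I0 : `[0, h]%classic !=set0 by exists 0; rewrite /= in_itv/= lexx.
have uI : has_ubound `[0, h]%classic by exists h => x /=; rewrite in_itv/= => /andP[].
have lI : has_lbound `[0, h]%classic by exists 0 => x /=; rewrite in_itv/= => /andP[].
rewrite !lebesgue_measure_bounded_interval//.
- rewrite sup_sumE// inf_sumE// sup_itvcc// inf_itvcc// -EFinD; congr EFin; ring.
- move=> x y /= [a Sa [b]] /=; rewrite in_itv/= => /andP[b0 bh] <-{x}.
  move=> [a' Sa' [b']] /=; rewrite in_itv/= => /andP[b'0 b'h] <-{y} z /andP[xz zy].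
  (* [z] is decomposed over [a], over itself or over [a'], according to its position; no order
     between [a] and [a'] is assumed. *)
  have [za|az] := leP z a.
    by exists a => //; exists (z - a); [rewrite in_itv/=; apply/andP; split; lra|lra].
  have [za'|a'z] := leP z a'.
    exists z; first by apply: (iS a a') => //; rewrite za' ltW.
    by exists 0; rewrite ?addr0//= in_itv/= lexx.
  exists a' => //; exists (z - a'); last by lra.
  by rewrite /= in_itv/=; apply/andP; split; lra.
- by have [s Ss] := S0; exists s, s => //; exists 0; rewrite ?addr0//= in_itv/= lexx.
- have [m mS] := lS; exists m => z [a Sa [b /=]]; rewrite in_itv/= => /andP[b0 _] <-.
  by rewrite (le_trans (mS _ Sa))// lerDl.
- have [m mS] := uS; exists (m + h) => z [a Sa [b /=]]; rewrite in_itv/= => /andP[_ bh] <-.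
  by rewrite lerD//; exact: mS.
Qed.

End lebesgue_measure_interval.

Section zonotope_volume.
Context (R : realType).

Lemma Zon_cons d n (v : vec R d) (xs : n.-tuple (vec R d)) (y : vec R d) :
  Zon (tnth (cons_pair (v, xs))) y <->
  exists2 tau : R, 0 <= tau <= 1 &
    Zon (tnth xs) [tuple ((tnth y j : R) - tau * tnth v j)%R | j < d].
Proof.
split=> [[t [t01 yE]]|[tau tau01 [t [t01 yE]]]].
  exists (t ord0) => //; exists (fun i => t (lift ord0 i)); split=> // j.
  rewrite tnth_mktuple yE big_ord_recl tnth_cons_pair0 /= addrAC subrr add0r.
  by apply: eq_bigr => i _; rewrite tnth_cons_pairS.
exists (fun i => oapp t tau (unlift ord0 i)); split=> [i|j].
  by case: unlift.
rewrite big_ord_recl tnth_cons_pair0 unlift_none /=.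
have := yE j; rewrite tnth_mktuple => /eqP; rewrite subr_eq addrC => /eqP ->.
by congr (_ + _); apply: eq_bigr => i _; rewrite tnth_cons_pairS liftK.
Qed.

Definition axis_vec d (h : R) : vec R d.+1 := cons_pair (h, [tuple 0 | j < d]).

Definition zslice d n (xs : n.-tuple (vec R d.+1)) (y : vec R d) : set R :=
  [set s | Zon (tnth xs) (cons_pair (s, y))].

Definition vtails d n (xs : n.-tuple (vec R d.+1)) : n.-tuple (vec R d) :=
  [tuple (uncons_pair (tnth xs i)).2 | i < n].

Lemma zslice_axis d n (h : R) (xs : n.-tuple (vec R d.+1)) y : 0 <= h ->
  zslice (cons_pair (axis_vec d h, xs)) y =
  [set a + b | a in zslice xs y & b in `[0, h]%classic].
Proof.
move=> h0.
have axisE s tau : [tuple ((tnth (cons_pair (s, y)) j : R) -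
    tau * tnth (axis_vec d h) j)%R | j < d.+1] = cons_pair ((s - tau * h)%R, y).
  rewrite mktupleS !tnth_cons_pair0; congr (cons_pair (_, _)).
  apply: eq_from_tnth => j.
  by rewrite tnth_mktuple !tnth_cons_pairS /= tnth_mktuple mulr0 subr0.
apply/seteqP; split=> s /=.
  move=> /Zon_cons[tau /andP[tau0 tau1]]; rewrite axisE => sz.
  exists (s - tau * h)%R => //; exists (tau * h); last by rewrite subrK.
  by rewrite in_itv/= mulr_ge0//= ler_piMl.
move=> [a az [b]] /[!in_itv]/= /andP[b0 bh] <-; apply/Zon_cons.
(* The parameter of the added segment is [b / h]; for [h = 0] the shift [b] is 0 and any parameter
   would do. *)
have [h_eq0|hn0] := eqVneq h 0.
  exists 0; first by rewrite lexx ler01.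
  rewrite axisE mul0r subr0 (_ : b = 0) ?addr0//.
  by apply/eqP; rewrite eq_le b0 andbT -h_eq0.
have hgt0 : 0 < h by rewrite lt_neqAle eq_sym hn0.
exists (b / h); first by rewrite divr_ge0//= ler_pdivrMr// mul1r.
by rewrite axisE divfK// addrK.
Qed.

Lemma zslice_interval d n (xs : n.-tuple (vec R d.+1)) y : is_interval (zslice xs y).
Proof.
move=> a b [t [t01 ya]] [u [u01 yb]] z /andP[az zb].
have [ab|ab] := eqVneq a b.
  rewrite (_ : z = a); first by exists t.
  by apply/eqP; rewrite eq_le az ab zb.
have lt_ab : 0 < b - a by rewrite subr_gt0 lt_neqAle ab (le_trans az).
(* [z] is the barycentre of [a] and [b] with weights [1 - l] and [l]; the same weights combine the
   two parameter vectors. *)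
pose l := (z - a) / (b - a).
have l0 : 0 <= l by rewrite divr_ge0 ?subr_ge0// ltW// -subr_gt0.
have l1 : l <= 1 by rewrite ler_pdivrMr// mul1r lerD2r.
exists (fun i => (1 - l) * t i + l * u i); split=> [i|j].
  have /andP[t0 t1] := t01 i; have /andP[u0 u1] := u01 i.
  by apply/andP; split; nra.
transitivity ((1 - l) * (tnth (cons_pair (a, y)) j : R) + l * tnth (cons_pair (b, y)) j).
  have [k ->|->] := unliftP ord0 j.
    by rewrite !tnth_cons_pairS/=; ring.
  by rewrite !tnth_cons_pair0 /l/=; field; rewrite gt_eqF.
rewrite ya yb !mulr_sumr -big_split/=; apply: eq_bigr => i _; ring.
Qed.

Lemma zslice_bound d n (xs : n.-tuple (vec R d.+1)) y s : zslice xs y s ->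
  `|s| <= \sum_(i < n) `|tnth (tnth xs i) ord0 : R|.
Proof.
move=> [t [t01 /(_ ord0)]]; rewrite tnth_cons_pair0/= => ->.
apply: le_trans (ler_norm_sum _ _ _) _; apply: ler_sum => i _.
by have /andP[t0 t1] := t01 i; rewrite normrM (ger0_norm t0) ler_piMl.
Qed.

(** The projection of a zonotope is the zonotope of the projected vectors, with the same parameters;
    the head of the point is then free. *)
Lemma zslice_neq0 d n (xs : n.-tuple (vec R d.+1)) y :
  zslice xs y !=set0 <-> Zon (tnth (vtails xs)) y.
Proof.
split=> [[s [t [t01 yE]]]|[t [t01 yE]]].
  exists t; split=> // j; have := yE (lift ord0 j); rewrite tnth_cons_pairS /= => ->.
  by apply: eq_bigr => i _; rewrite tnth_mktuple tnth_uncons_pair2.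
exists (\sum_(i < n) t i * (tnth (tnth xs i) ord0 : R)), t; split=> // j.
have [k ->|->] := unliftP ord0 j; rewrite ?tnth_cons_pair0// tnth_cons_pairS /= yE.
by apply: eq_bigr => i _; rewrite tnth_mktuple tnth_uncons_pair2.
Qed.

Local Open Scope ereal_scope.

Lemma measurable_Zon_section d n (xs : n.-tuple (vec R d)) :
  measurable (Zon (tnth xs)).
Proof.
have := measurable_xsection xs (@measurable_Zon R d n).
by rewrite xsectionE.
Qed.

Lemma measurable_lebesgue_Zon d n :
  measurable_fun setT (fun xs : n.-tuple (vec R d) => lebesgue_vec R d (Zon (tnth xs))).
Proof.
rewrite (_ : (fun _ => _) = lebesgue_vec R d \o
    xsection [set p : n.-tuple (vec R d) * vec R d | Zon (tnth p.1) p.2]).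
  by apply: measurable_fun_xsection; exact: measurable_Zon.
by apply/funext => xs /=; rewrite xsectionE.
Qed.

Lemma lebesgue_vec_slices d (A : set (vec R d.+1)) : measurable A ->
  lebesgue_vec R d.+1 A =
  \int[lebesgue_vec R d]_y lebesgue_measure [set s | A (cons_pair (s, y))].
Proof.
move=> mA; rewrite -[in LHS](setIT A) -integral_indic//.
have mi : measurable_fun setT (fun x => (\1_A x)%:E : \bar R).
  exact/measurable_EFinP/measurable_indic.
rewrite integral_power_measureS'//; apply: eq_integral => y _.
rewrite -[in RHS](setIT [set s | _]) -integral_indic//.
rewrite -[X in measurable X]setTI.
exact: (@measurable_cons_pair2 _ _ d y measurableT A mA).
Qed.

Lemma lebesgue_Zon_axis d n (h : R) (xs : n.-tuple (vec R d.+1)) : (0 <= h)%R ->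
  lebesgue_vec R d.+1 (Zon (tnth (cons_pair (axis_vec d h, xs)))) =
  lebesgue_vec R d.+1 (Zon (tnth xs)) +
  h%:E * lebesgue_vec R d (Zon (tnth (vtails xs))).
Proof.
move=> h0; rewrite !lebesgue_vec_slices; [|exact: measurable_Zon_section..].
have mt := measurable_Zon_section (vtails xs).
have mi : measurable_fun setT (fun y => (\1_(Zon (tnth (vtails xs))) y)%:E : \bar R).
  exact/measurable_EFinP/measurable_indic.
have ms : measurable_fun setT (fun y => lebesgue_measure (zslice xs y)).
  rewrite (_ : (fun _ => _) = lebesgue_measure \o
      ysection (@cons_pair (measurableTypeR R) d @^-1` Zon (tnth xs))); last first.
    by apply/funext => y /=; rewrite ysectionE.
  apply: measurable_fun_ysection; rewrite -[X in measurable X]setTI.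
  by apply: measurable_cons_pair => //; exact: measurable_Zon_section.
rewrite -[in RHS](setIT (Zon (tnth (vtails xs)))) -integral_indic//.
rewrite -ge0_integralZl//.
rewrite -ge0_integralD//.
- apply: eq_integral => y _.
  rewrite -/(zslice _ y) -/(zslice xs y) zslice_axis// indicE.
  (* A nonempty slice gains length [h], while an empty one stays empty; this is the indicator of the
     projection. *)
  have [/zslice_neq0 zn0|zn0] := pselect (Zon (tnth (vtails xs)) y).
    rewrite lebesgue_measure_interval_sum//.
    + by rewrite mem_set ?mule1//; apply/zslice_neq0.
    + exact: zslice_interval.
    + exists (- \sum_(i < n) `|tnth (tnth xs i) ord0 : R|)%R => s /zslice_bound.
      by rewrite ler_norml => /andP[].
    + exists (\sum_(i < n) `|tnth (tnth xs i) ord0 : R|)%R => s /zslice_bound.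
      by rewrite ler_norml => /andP[].
  rewrite memNset// mule0 adde0.
  have -> : zslice xs y = set0.
    by apply/eqP/negPn/negP => /set0P /zslice_neq0.
  by congr (lebesgue_measure _); apply/seteqP; split => // s [? []].
- by move=> y _; rewrite mule_ge0// lee_fin.
- exact: measurable_funeM.
Qed.

End zonotope_volume.

(** * Recursion for the expected volume *)

Section zonotope_expectation.
Context (R : realType).
Local Open Scope ereal_scope.

Lemma std_normal_vecT d : std_normal_vec R d setT = 1.
Proof. by apply: power_measureT; exact: probability_setT. Qed.

Lemma lebesgue_vec_householder d (a : R) (v : vec R d) k (A : set (vec R d.+1)) :
  (a != 0)%R -> (k * dotv (cons_pair (a, v)) (cons_pair (a, v)) = 2)%R ->
  measurable A ->
  lebesgue_vec R d.+1 (householder (cons_pair (a, v)) k @^-1` A) =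
  lebesgue_vec R d.+1 A.
Proof.
move=> a0 ku mA; set H := householder _ _.
have mHA : measurable (H @^-1` A).
  by rewrite -[X in measurable X]setTI; exact: measurable_householder.
rewrite -[in LHS](setIT (_ @^-1` _)) -integral_indic//.
rewrite -[in RHS](setIT A) -integral_indic//.
apply: (integral_lebesgue_vec_householder (f := fun x => (\1_A x)%:E) a0 ku) => //.
exact/measurable_EFinP/measurable_indic.
Qed.

Lemma Zon_householder_sub d n (u : vec R d) k (xs : n.-tuple (vec R d)) y :
  Zon (tnth xs) y ->
  Zon (tnth [tuple householder u k (tnth xs i) | i < n]) (householder u k y).
Proof.
move=> [t [t01 yE]]; exists t; split=> // j.
have uy : dotv u y = (\sum_(i < n) t i * dotv u (tnth xs i))%R.
  rewrite /dotv; under [RHS]eq_bigr do rewrite mulr_sumr.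
  rewrite exchange_big/=; apply: eq_bigr => l _; rewrite yE mulr_sumr.
  by apply: eq_bigr => i _; rewrite mulrCA.
rewrite tnth_mktuple yE uy mulr_sumr mulr_suml -sumrB; apply: eq_bigr => i _.
rewrite tnth_mktuple tnth_mktuple; ring.
Qed.

(** The reflection is an involution, so the inclusion given by linearity, used twice, is an
    equality. *)
Lemma Zon_householder d n (u : vec R d) k (xs : n.-tuple (vec R d)) :
  (k * dotv u u = 2)%R ->
  householder u k @^-1` Zon (tnth [tuple householder u k (tnth xs i) | i < n]) =
  Zon (tnth xs).
Proof.
move=> ku; apply/seteqP; split=> y /=; last exact: Zon_householder_sub.
move=> /(Zon_householder_sub u k); rewrite (householderK ku).
congr (Zon (tnth _) y); apply: eq_from_tnth => i.
by rewrite !tnth_mktuple householderK.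
Qed.

(** The mirror bisects [x] and its target, so the normal is [x - |x| e_1]. Its head [a = t - |x|]
    vanishes exactly when [x] already lies on the nonnegative half-axis, which is the first
    alternative; otherwise [a != 0], as the factorization into shears demands. *)
Lemma householder_to_axis d (x : vec R d.+1) :
  x = axis_vec d (enorm x) \/
  exists a v k, [/\ (a != 0)%R,
    (k * dotv (cons_pair (a, v)) (cons_pair (a, v)) = 2)%R &
    householder (cons_pair (a, v)) k x = axis_vec d (enorm x)].
Proof.
rewrite -(uncons_pairK x); case: (uncons_pair x) => t y {x}.
set x := cons_pair (t, y).
have xx : (enorm x ^+ 2 = t ^+ 2 + dotv y y)%R.
  by rewrite sqr_enorm dotv_cons/= -expr2.
have [tx|tx] := eqVneq (t : R) (enorm x); [left|right].
  rewrite /axis_vec -tx; congr cons_pair; congr pair; apply: eq_from_tnth => j.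
  rewrite tnth_mktuple; apply/eqP; rewrite -sqrf_eq0.
  have /eqP : dotv y y = 0%R.
    by apply/eqP; rewrite -(inj_eq (addrI (t ^+ 2)%R)) -xx -tx addr0.
  rewrite psumr_eq0 => [/allP/(_ j (mem_index_enum _))|i _]; last by rewrite -expr2 sqr_ge0.
  by rewrite -expr2.
(* [q] is both half of [<u, u>] and [<u, x>]. Hence [k = 1 / q], and the reflection subtracts
   exactly [u] from [x]. *)
pose q : R := (enorm x ^+ 2 - enorm x * t)%R.
have q0 : (q != 0)%R.
  rewrite /q expr2 -mulrBr mulf_neq0//; last by rewrite subr_eq0 eq_sym.
  apply: contra tx => /eqP x0; move: xx; rewrite x0 expr0n/= => /eqP.
  by rewrite eq_sym paddr_eq0 ?sqr_ge0 ?dotv_ge0// sqrf_eq0 => /andP[].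
exists (t - enorm x)%R, y, q^-1%R.
set u := cons_pair _.
have uu : dotv u u = (2 * q)%R.
  rewrite dotv_cons/=; have -> : dotv y y = (enorm x ^+ 2 - t ^+ 2)%R by rewrite xx; ring.
  by rewrite /q; ring.
have ux : dotv u x = q.
  rewrite dotv_cons/=; have -> : dotv y y = (enorm x ^+ 2 - t ^+ 2)%R by rewrite xx; ring.
  by rewrite /q; ring.
split; first by rewrite subr_eq0.
  by rewrite uu; field.
rewrite /householder ux mktupleS !tnth_cons_pair0 mulVf//; congr cons_pair; congr pair.
  by rewrite mul1r /=; ring.
by apply: eq_mktuple => j; rewrite !tnth_cons_pairS mul1r subrr.
Qed.

Definition zon_expectation d n : \bar R :=
  \int[power_measure (std_normal_vec R d) n]_xs lebesgue_vec R d (Zon (tnth xs)).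

Lemma zon_expectation_ge0 d n : 0 <= zon_expectation d n.
Proof. by apply: integral_ge0. Qed.

Definition enorm_expectation d : \bar R := \int[std_normal_vec R d]_x (enorm x)%:E.

Lemma zon_expectation0n n : zon_expectation 0 n = 1.
Proof.
rewrite /zon_expectation (eq_integral (cst 1)) => [|xs _].
  rewrite integral_cst// mul1e; apply: power_measureT.
  exact: std_normal_vecT.
rewrite /lebesgue_vec /= diracE mem_set//.
by exists (fun=> 0%R); split=> [i|[]//]; rewrite lexx ler01.
Qed.

Lemma zon_expectationS0 d : zon_expectation d.+1 0 = 0.
Proof.
rewrite /zon_expectation; apply: integral0_eq => xs _.
(* The zonotope of no vectors is the origin, a box whose sides are null sets. *)
rewrite (_ : Zon _ = [set y | forall i, [set 0%R] (tnth y i)]); last first.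
  apply/seteqP; split=> [y [t [_ yE]] i /=|y /= y0]; first by rewrite yE big_ord0.
  exists (fun=> 0%R); split=> [i|j]; first by rewrite lexx ler01.
  by rewrite big_ord0 y0.
transitivity (\prod_(i < d.+1) @lebesgue_measure R [set 0%R]).
  exact: (@power_measure_box _ _ R (@lebesgue_measure R) d.+1 (fun=> [set 0%R])
    (fun=> measurable_set1 0%R)).
by rewrite big_ord_recl lebesgue_measure_set1 mul0e.
Qed.

Lemma integral_lebesgue_Zon_axis d n (h : R) : (0 <= h)%R ->
  \int[power_measure (std_normal_vec R d.+1) n]_xs
     lebesgue_vec R d.+1 (Zon (tnth (cons_pair (axis_vec d h, xs)))) =
  zon_expectation d.+1 n + h%:E * zon_expectation d n.
Proof.
move=> h0; under eq_integral do rewrite lebesgue_Zon_axis//.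
have muncons : measurable_fun setT (fun x : vec R d.+1 => (uncons_pair x).2).
  by apply: measurableT_comp => //; exact: measurable_uncons_pair.
have mt : measurable_fun setT (fun xs : n.-tuple (vec R d.+1) =>
    lebesgue_vec R d (Zon (tnth (vtails xs)))).
  apply: (measurableT_comp (@measurable_lebesgue_Zon R d n)).
  exact: (measurable_mktuple_map (F := fun _ (x : vec R d.+1) => (uncons_pair x).2)).
rewrite ge0_integralD//; last 3 first.
- exact: measurable_lebesgue_Zon.
- by move=> xs _; rewrite mule_ge0// lee_fin.
- exact: measurable_funeM.
congr (_ + _); rewrite ge0_integralZl//; congr (_ * _).
(* Dropping the head of every vector sends the Gaussian law in dimension [d.+1] to the one in
   dimension [d]. *)
rewrite /vtails (@integral_power_measure_map _ _ _ _ R (std_normal_vec R d.+1)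
  (std_normal_vec R d) 1 ler01 n (fun _ x => (uncons_pair x).2)
  (fun xs => lebesgue_vec R d (Zon (tnth xs))))//.
- by rewrite expr1n mul1e.
- move=> i g mg g0; rewrite mul1e; apply: integral_power_measure_behead => //.
  exact: probability_setT.
- exact: measurable_lebesgue_Zon.
Qed.

Lemma integral_lebesgue_Zon_cons d n (x : vec R d.+1) :
  \int[power_measure (std_normal_vec R d.+1) n]_xs
     lebesgue_vec R d.+1 (Zon (tnth (cons_pair (x, xs)))) =
  zon_expectation d.+1 n + (enorm x)%:E * zon_expectation d n.
Proof.
rewrite -(integral_lebesgue_Zon_axis d n (enorm_ge0 x)).
have [xE|[a [v [k [a0 ku Hx]]]]] := householder_to_axis x.
  by rewrite -xE.
rewrite -Hx; set H := householder _ _.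
have mf : measurable_fun setT (fun xs : n.-tuple (vec R d.+1) =>
    lebesgue_vec R d.+1 (Zon (tnth (cons_pair (H x, xs))))).
  apply: (measurableT_comp (@measurable_lebesgue_Zon R d.+1 n.+1)).
  exact: measurable_cons_pair1.
have g0 xs : 0 <= lebesgue_vec R d.+1 (Zon (tnth (cons_pair (H x, xs : n.-tuple _)))).
  by [].
have HE (g : vec R d.+1 -> \bar R) : measurable_fun setT g -> (forall y, 0 <= g y) ->
    \int[std_normal_vec R d.+1]_y g (H y) = 1%:E * \int[std_normal_vec R d.+1]_y g y.
  by move=> mg ge0; rewrite mul1e; exact: integral_std_normal_vec_householder.
have := @integral_power_measure_map _ _ _ _ R (std_normal_vec R d.+1)
  (std_normal_vec R d.+1) 1 ler01 n (fun _ => H)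
  (fun xs => lebesgue_vec R d.+1 (Zon (tnth (cons_pair (H x, xs)))))
  (fun _ => measurable_householder _ _) (fun _ => HE) mf g0.
rewrite expr1n mul1e => <-; apply: eq_integral => xs _.
(* All [n.+1] vectors are reflected together, which keeps the volume. Then [x] lands on the axis,
   and the reflection of [xs] is absorbed by its law. *)
rewrite -[in LHS](Zon_householder (cons_pair (x, xs)) ku).
rewrite (lebesgue_vec_householder a0 ku); last exact: measurable_Zon_section.
congr (lebesgue_vec R d.+1 (Zon (tnth _))); rewrite mktupleS tnth_cons_pair0.
congr (cons_pair (_, _)).
by apply: eq_mktuple => i; rewrite tnth_cons_pairS.
Qed.

Lemma zon_expectationSS d n :
  zon_expectation d.+1 n.+1 =
  zon_expectation d.+1 n + enorm_expectation d.+1 * zon_expectation d n.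
Proof.
rewrite [LHS]integral_power_measureS//; last exact: measurable_lebesgue_Zon.
under eq_integral do rewrite integral_lebesgue_Zon_cons.
have me : measurable_fun setT (fun x : vec R d.+1 => (enorm x)%:E : \bar R).
  by apply/measurable_EFinP; exact: measurable_enorm.
rewrite ge0_integralD//.
- congr (_ + _).
    rewrite integral_cst//; transitivity (zon_expectation d.+1 n * 1); last exact: mule1.
    by congr (_ * _); exact: std_normal_vecT.
  rewrite ge0_integralZr//; last exact: zon_expectation_ge0.
  by move=> x _; rewrite lee_fin enorm_ge0.
- by move=> x _; exact: zon_expectation_ge0.
- by move=> x _; rewrite mule_ge0 ?lee_fin ?enorm_ge0 ?zon_expectation_ge0.
- by apply: emeasurable_funM.
Qed.

End zonotope_expectation.

(** * Mean norm of a Gaussian vector *)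

Section tail_integrals.
Context (R : realType).
Notation mu := (@lebesgue_measure R).

Lemma FTC2y_is_derive (f F : R -> R) (a : R) :
  (forall x, a <= x -> 0 <= f x) -> continuous f ->
  (forall x : R, is_derive x 1 F (f x)) -> F x @[x --> +oo] --> 0 ->
  (\int[mu]_(x in `[a, +oo[) (f x)%:E = (- F a)%:E)%E.
Proof.
move=> f0 cf dF F0.
have dbF (x : R) : derivable F x 1 by case: (dF x).
have cF : F x @[x --> a^'+] --> F a.
  apply: cvg_at_right_filter; apply: differentiable_continuous.
  exact/derivable1_diffP.
have FE : {in `]a, +oo[, derive1 F =1 f}.
  by move=> x _; rewrite derive1E; apply: derive_val; exact: dF.
by rewrite (ge0_continuous_FTC2y f0 (continuous_subspaceT cf) F0 (fun x _ => dbF x) cF FE)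
  sub0e.
Qed.

Lemma integral_expRN_tail (q : R) :
  (\int[mu]_(r in `[q, +oo[) (expR (- r))%:E = (expR (- q))%:E)%E.
Proof.
rewrite -[in RHS](opprK (expR (- q))).
apply: (@FTC2y_is_derive _ (fun r => - expR (- r))).
- by move=> x _; exact: expR_ge0.
- move=> x; apply: (@continuous_comp _ _ _ (fun r : R => - r) expR).
    by apply: (@cvgN _ R^o); exact: cvg_id.
  exact: continuous_expR.
- move=> x.
  have := is_deriveN (is_derive1_comp (is_derive_expR (- x)) (is_deriveNid x 1)).
  by rewrite mulrN1 opprK.
- by rewrite -oppr0; apply: (@cvgN _ R^o); exact: cvgr_expR.
Qed.

Definition half_gauss (r : R) : R := expR (- (r ^+ 2 / 2)).

Lemma half_gauss_gt0 r : 0 < half_gauss r. Proof. exact: expR_gt0. Qed.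

Lemma is_derive_half_gauss (x : R) : is_derive x 1 half_gauss (- (x * half_gauss x)).
Proof.
pose g : R -> R := - (2^-1 \*: ((@id R) ^+ 2)).
have gE r : g r = - (r ^+ 2 / 2) by rewrite mulrC.
have dg : is_derive x 1 g (- x).
  apply: is_derive_eq; rewrite /= /GRing.scale /= expr1 mulr1 mulrA mulVf ?mul1r//.
rewrite (_ : half_gauss = expR \o g); last by apply/funext => r /=; rewrite gE.
have := is_derive1_comp (is_derive_expR (g x)) dg.
by rewrite mulrN [expR _ * x]mulrC.
Qed.

Lemma continuous_half_gauss : continuous half_gauss.
Proof.
move=> x; apply: differentiable_continuous; apply/derivable1_diffP.
by have [] := is_derive_half_gauss x.
Qed.

Lemma cvg_half_gauss : half_gauss x @[x --> +oo] --> (0 : R).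
Proof.
apply: (cvg_comp (fun x => x ^+ 2 / 2) (fun x => expR (- x))); last exact: cvgr_expR.
by apply: gt0_cvgMly => //; exact: cvgr_expr2.
Qed.

Lemma integral_half_gauss_tail (s : R) : 0 <= s ->
  (\int[mu]_(r in `[s, +oo[) (r * half_gauss r)%:E = (half_gauss s)%:E)%E.
Proof.
move=> s0; rewrite -[in RHS](opprK (half_gauss s)).
apply: (@FTC2y_is_derive _ (fun r => - half_gauss r)).
- by move=> x sx; apply: mulr_ge0; [exact: le_trans s0 sx|exact/ltW/half_gauss_gt0].
- by move=> x; apply: cvgM; [exact: cvg_id|exact: continuous_half_gauss].
- move=> x; rewrite -[X in is_derive _ _ _ X]opprK.
  by apply: is_deriveN; exact: is_derive_half_gauss.
- by rewrite -oppr0; apply: (@cvgN _ R^o); exact: cvg_half_gauss.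
Qed.

Lemma integral_monomial k (s r : R) : s <= r ->
  (\int[mu]_(t in `[s, r]) (k.+1%:R * t ^+ k)%:E = (r ^+ k.+1 - s ^+ k.+1)%:E)%E.
Proof.
rewrite le_eqVlt => /predU1P[<-|sr].
  by rewrite set_itv1 integral_set1 subrr.
have dX (x : R) : is_derive x 1 (fun t : R => t ^+ k.+1) (k.+1%:R * x ^+ k).
  have := is_deriveX k.+1 (is_derive_id x 1); rewrite /GRing.scale/= mulr1.
  by rewrite (_ : _ ^+ _ = fun t : R => t ^+ k.+1)//; apply/funext => t; rewrite exprfctE.
rewrite (@continuous_FTC2 _ _ (fun t : R => t ^+ k.+1) _ _ sr) ?EFinB//.
- apply: continuous_subspaceT => x; apply: cvgM; first exact: cvg_cst.
  exact: exprn_continuous.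
- split=> [x _|//|].
  + by have [] := dX x.
  + by apply: cvg_at_right_filter; exact: exprn_continuous.
  + by apply: cvg_at_left_filter; exact: exprn_continuous.
- by move=> x _; rewrite derive1E; have [] := dX x.
Qed.

End tail_integrals.

Section layer_cake.
Context d (T : measurableType d) (R : realType).
Variable m : {sigma_finite_measure set T -> \bar R}.
Notation mu := (@lebesgue_measure R).
Local Open Scope ereal_scope.

Variables (q w : T -> R) (g : R -> R).
Hypothesis mq : measurable_fun setT q.
Hypothesis mw : measurable_fun setT w.
Hypothesis mg : measurable_fun setT g.
Hypothesis wg0 : forall x r, (q x <= r -> 0 <= w x * g r)%R.

Let A : set (T * measurableTypeR R) := [set p | (q p.1 <= p.2)%R].
Let f (p : T * measurableTypeR R) := (w p.1 * g p.2 * \1_A p)%:E.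

Let mf : measurable_fun setT f.
Proof.
have mA : measurable A.
  rewrite (_ : A = (fun p : T * measurableTypeR R => p.2 - q p.1)%R @^-1` `[0%R, +oo[).
    rewrite -[X in measurable X]setTI.
    by apply: measurable_funB => //; exact: measurableT_comp.
  by apply/seteqP; split=> p /=; rewrite in_itv/= andbT subr_ge0.
apply/measurable_EFinP; apply: measurable_funM => //.
by apply: measurable_funM; apply: measurableT_comp.
Qed.

Let f0 p : 0 <= f p.
Proof.
rewrite lee_fin indicE; case: (boolP (p \in A)) => [|_]; last by rewrite mulr0.
by rewrite mulr1 inE => /wg0.
Qed.

Let tailE x : \int[mu]_(r in `[q x, +oo[) (w x * g r)%:E = \int[mu]_r f (x, r).
Proof.
rewrite integral_mkcond; apply: eq_integral => r _.
rewrite patchE /f indicE/=; case: ifPn => [|/negP].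
  by rewrite inE/= in_itv/= andbT => qr; rewrite mem_set// mulr1.
by rewrite inE/= in_itv/= andbT => qr; rewrite memNset ?mulr0.
Qed.

Lemma measurable_tail_integral :
  measurable_fun setT (fun x => \int[mu]_(r in `[q x, +oo[) (w x * g r)%:E).
Proof.
under eq_fun do rewrite tailE.
exact: (measurable_fun_fubini_tonelli_F f mf f0).
Qed.

(** Tonelli on the region [q x <= r]. Nonnegativity is required on that region only, since
    integrands such as [r * half_gauss r] are negative for [r < 0]; the indicator in [f] makes them
    nonnegative everywhere. *)
Lemma layer_cake :
  \int[m]_x \int[mu]_(r in `[q x, +oo[) (w x * g r)%:E =
  \int[mu]_r \int[m]_(x in [set x | (q x <= r)%R]) (w x * g r)%:E.
Proof.
under eq_integral do rewrite tailE.
transitivity (\int[mu]_r \int[m]_x f (x, r)).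
  exact: (@fubini_tonelli _ _ T (measurableTypeR R) R m mu f mf f0).
apply: eq_integral => r _; rewrite [RHS]integral_mkcond; apply: eq_integral => x _.
rewrite patchE /f indicE/=; case: ifPn => [|/negP].
  by rewrite inE/= => qr; rewrite mem_set// mulr1.
by rewrite inE/= => qr; rewrite memNset ?mulr0.
Qed.

End layer_cake.

Section half_gauss_moments.
Context (R : realType).
Notation mu := (@lebesgue_measure R).
Local Open Scope ereal_scope.

Lemma half_gauss_ge0 (r : R) : (0 <= half_gauss r)%R.
Proof. exact/ltW/half_gauss_gt0. Qed.

Lemma measurable_half_gauss : measurable_fun setT (@half_gauss R).
Proof. apply: continuous_measurable_fun; exact: continuous_half_gauss. Qed.

Lemma measurable_monomial_half_gauss k :
  measurable_fun setT (fun r : R => r ^+ k * half_gauss r)%R.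
Proof. by apply: measurable_funM => //; exact: measurable_half_gauss. Qed.

(* Integration by parts, in the form of Tonelli's theorem applied to
   [r ^ (k + 1) = s ^ (k + 1) + \int_s^r (k + 1) t ^ k dt]. *)
Lemma integral_half_gauss_tailS k (s : R) : (0 <= s)%R ->
  \int[mu]_(r in `[s, +oo[) (r ^+ k.+2 * half_gauss r)%:E =
  (s ^+ k.+1 * half_gauss s)%:E +
  k.+1%:R%:E * \int[mu]_(r in `[s, +oo[) (r ^+ k * half_gauss r)%:E.
Proof.
move=> s0.
(* The indicator cuts the range [t <= r] of [layer_cake] down to [s <= t <= r]. *)
pose w (t : R) : R := (k.+1%:R * t ^+ k * \1_(`[s, +oo[%classic : set R) t)%R.
have mw : measurable_fun setT w.
  apply: measurable_funM => //; first by apply: measurable_funM.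
have mg : measurable_fun setT (fun r : R => r * half_gauss r)%R.
  by apply: measurable_funM => //; exact: measurable_half_gauss.
have wg0 (t r : R) : (t <= r -> 0 <= w t * (r * half_gauss r))%R.
  move=> tr; rewrite /w indicE; case: (boolP (_ \in _)) => [|_]; last by rewrite mulr0 mul0r.
  rewrite inE/= in_itv/= andbT => st; have t0 := le_trans s0 st.
  have r0 := le_trans t0 tr.
  by rewrite mulr1 !mulr_ge0// ?exprn_ge0// half_gauss_ge0.
have mid : measurable_fun setT (@id R) by exact: measurable_id.
have := @layer_cake _ (measurableTypeR R) R mu id w _ mid mw mg wg0.
have -> : \int[mu]_x \int[mu]_(r in `[id x, +oo[) (w x * (r * half_gauss r))%:E =
    k.+1%:R%:E * \int[mu]_(r in `[s, +oo[) (r ^+ k * half_gauss r)%:E.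
  transitivity (\int[mu]_(t in `[s, +oo[) (k.+1%:R%:E * (t ^+ k * half_gauss t)%:E)).
    rewrite [RHS]integral_mkcond; apply: eq_integral => t _.
    rewrite patchE; case: ifPn => [st|st]; last first.
      rewrite integral0_eq// => r _.
      by rewrite /w indicE (negbTE st) mulr0 mul0r.
    have t0 : (0 <= t)%R.
      by move: st; rewrite inE/= in_itv/= andbT; exact: le_trans.
    have wE : w t = (k.+1%:R * t ^+ k)%R by rewrite /w indicE st mulr1.
    under eq_integral do rewrite wE EFinM.
    rewrite ge0_integralZl//=.
    - by rewrite integral_half_gauss_tail// -!EFinM mulrA.
    - exact/measurable_funTS/measurable_EFinP.
    - move=> r; rewrite in_itv/= andbT => tr; rewrite lee_fin.
      by rewrite mulr_ge0 ?half_gauss_ge0// (le_trans t0).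
    - by rewrite lee_fin mulr_ge0// exprn_ge0.
  rewrite ge0_integralZl//=.
  - by apply/measurable_funTS/measurable_EFinP; exact: measurable_monomial_half_gauss.
  - move=> r; rewrite in_itv/= andbT => sr; rewrite lee_fin.
    by rewrite mulr_ge0 ?half_gauss_ge0// exprn_ge0// (le_trans s0).
move=> ->.
(* Splitting [r ^ (k + 1)] at its value in [s]: the first part is the boundary term, the second is
   the double integral with [t] innermost. *)
transitivity (\int[mu]_(r in `[s, +oo[) (s ^+ k.+1 * (r * half_gauss r))%:E +
    \int[mu]_(r in `[s, +oo[) ((r ^+ k.+1 - s ^+ k.+1) * (r * half_gauss r))%:E).
  rewrite -ge0_integralD//=.
  - apply: eq_integral => r _; rewrite -EFinD; congr EFin; rewrite !exprS; ring.
  - move=> r; rewrite in_itv/= andbT => sr; rewrite lee_fin.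
    by rewrite !mulr_ge0 ?half_gauss_ge0 ?exprn_ge0// (le_trans s0).
  - by apply/measurable_funTS/measurable_EFinP; apply: measurable_funM.
  - move=> r; rewrite in_itv/= andbT => sr; rewrite lee_fin.
    have r0 := le_trans s0 sr.
    by rewrite !mulr_ge0 ?half_gauss_ge0// subr_ge0 lerXn2r// nnegrE.
  - apply/measurable_funTS/measurable_EFinP; apply: measurable_funM => //.
    exact: measurable_funB.
congr (_ + _).
  under eq_integral do rewrite EFinM.
  rewrite ge0_integralZl//=.
  - by rewrite integral_half_gauss_tail// EFinM.
  - exact/measurable_funTS/measurable_EFinP.
  - move=> r; rewrite in_itv/= andbT => sr; rewrite lee_fin.
    by rewrite mulr_ge0 ?half_gauss_ge0// (le_trans s0).
  - by rewrite lee_fin exprn_ge0.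
rewrite integral_mkcond; apply: eq_integral => r _.
rewrite patchE; case: ifPn => [sr|sr]; last first.
  rewrite integral0_eq// => t /= tr; rewrite /w indicE.
  rewrite (_ : t \in _ = false) ?mulr0 ?mul0r//.
  apply/negbTE; apply: contra sr; rewrite !inE/= !in_itv/= !andbT => st.
  exact: le_trans tr.
have {}sr : (s <= r)%R by move: sr; rewrite inE/= in_itv/= andbT.
have r0 := le_trans s0 sr.
symmetry; transitivity (\int[mu]_(t in `[s, r]) ((k.+1%:R * t ^+ k)%:E * (r * half_gauss r)%:E)).
  rewrite [LHS]integral_mkcond [RHS]integral_mkcond; apply: eq_integral => t _.
  rewrite !patchE /w indicE.
  have -> : (t \in [set x : measurableTypeR R | (id x <= r)%R]) = (t <= r)%R.
    by apply/idP/idP; rewrite inE.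
  rewrite !mem_setE /= !in_itv/= andbT.
  case: (boolP (s <= t)%R) => st; case: (boolP (t <= r)%R) => tr //=.
    by rewrite mulr1 EFinM.
  by rewrite mulr0 mul0r.
rewrite ge0_integralZr//=.
- by rewrite integral_monomial// -EFinM.
- by apply/measurable_funTS/measurable_EFinP; apply: measurable_funM.
- move=> t; rewrite in_itv/= => /andP[st _].
  by rewrite lee_fin mulr_ge0// exprn_ge0// (le_trans s0).
- by rewrite lee_fin mulr_ge0// half_gauss_ge0.
Qed.

End half_gauss_moments.

Section enorm_moments.
Context (R : realType).
Notation mu := (@lebesgue_measure R).
Local Open Scope ereal_scope.

Lemma integral_nonneg_half_line (h : R -> \bar R) :
  measurable_fun (`]0%R, +oo[%classic : set R) h -> (forall r, (r < 0)%R -> h r = 0) ->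
  \int[mu]_r h r = \int[mu]_(r in `]0%R, +oo[) h r.
Proof.
move=> mh h0; rewrite integral_itv_obnd_cbnd// [RHS]integral_mkcond.
apply: eq_integral => r _; rewrite patchE mem_setE/= in_itv/= andbT.
by case: leP => // /h0.
Qed.

Definition ball_volume d : \bar R := lebesgue_vec R d [set x | (enorm x <= 1)%R].

Lemma measurable_enorm_le d (r : R) : measurable [set x : vec R d | (enorm x <= r)%R].
Proof.
rewrite (_ : mkset _ = @enorm R d @^-1` `]-oo, r]); last first.
  by apply/seteqP; split=> x /=; rewrite in_itv.
by rewrite -[X in measurable X]setTI; exact: measurable_enorm.
Qed.

Lemma enorm_scale d (r : R) (x : vec R d) : (0 < r)%R ->
  enorm ([tuple ((tnth x i : R) / r)%R | i < d] : vec R d) = (enorm x / r)%R.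
Proof.
move=> r0; apply/eqP; rewrite -(@eqrXn2 _ 2)//; last 2 first.
- exact: enorm_ge0.
- by rewrite divr_ge0 ?enorm_ge0// ltW.
rewrite exprMn !sqr_enorm /dotv mulr_suml; apply/eqP; apply: eq_bigr => i _.
by rewrite !tnth_mktuple; field; rewrite gt_eqF.
Qed.

Lemma lebesgue_vec_ball d (r : R) : (0 < r)%R ->
  lebesgue_vec R d [set x | (enorm x <= r)%R] = (r ^+ d)%:E * ball_volume d.
Proof.
move=> r0; have mB := @measurable_enorm_le d 1; have mr := @measurable_enorm_le d r.
rewrite /ball_volume -[in RHS](setIT [set x | _]) -integral_indic//.
rewrite -integral_lebesgue_vec_scale//; last exact/measurable_EFinP/measurable_indic.
rewrite -[in LHS](setIT [set x | _]) -integral_indic//.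
apply: eq_integral => x _; rewrite !indicE.
congr (nat_of_bool _)%:R%:E; apply/idP/idP; rewrite !inE/= enorm_scale//.
  by rewrite ler_pdivrMr// mul1r.
by rewrite ler_pdivrMr// mul1r.
Qed.

(* [p] inverts [q] on the half line, so that [q (enorm x) <= r] describes the ball
   of radius [p r]. *)
Lemma integral_tails_enorm d (q : R -> R) (p : R -> R) (g : R -> R) :
  measurable_fun setT q -> measurable_fun setT g ->
  (forall s r, 0 <= s -> 0 <= r -> (q s <= r) = (s <= p r))%R ->
  (forall s, 0 <= s -> 0 <= q s)%R ->
  (forall r, 0 < r -> 0 < p r)%R ->
  (forall r, 0 <= r -> 0 <= g r)%R -> measurable_fun setT p ->
  \int[lebesgue_vec R d]_x \int[mu]_(r in `[q (enorm x), +oo[) (g r)%:E =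
  ball_volume d * \int[mu]_(r in `]0%R, +oo[) (p r ^+ d * g r)%:E.
Proof.
move=> mq mg qp q0 p0 g0 mp.
have mqe : measurable_fun setT (fun x : vec R d => q (enorm x)).
  by apply: measurableT_comp => //; exact: measurable_enorm.
transitivity (\int[lebesgue_vec R d]_x
    \int[mu]_(r in `[q (enorm x), +oo[) (1 * g r)%:E).
  by apply: eq_integral => x _; under [RHS]eq_integral do rewrite mul1r.
rewrite (@layer_cake _ _ R (lebesgue_vec R d) (fun x => q (enorm x)) (fun=> 1%R) g)//; last first.
  by move=> x r qr; rewrite mul1r g0// (le_trans (q0 _ (enorm_ge0 x))).
have inner r : (0 < r)%R ->
    \int[lebesgue_vec R d]_(x in [set x | (q (enorm x) <= r)%R]) (1 * g r)%:E =
    (p r ^+ d * g r)%:E * ball_volume d.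
  move=> r0; rewrite (_ : mkset _ = [set x | (enorm x <= p r)%R]); last first.
    by apply/seteqP; split=> x /=; rewrite qp ?enorm_ge0// ltW.
  transitivity ((1 * g r)%:E * lebesgue_vec R d [set x | (enorm x <= p r)%R]).
    exact: (integral_cst (lebesgue_vec R d) (@measurable_enorm_le d (p r))).
  by rewrite mul1r lebesgue_vec_ball ?p0// muleA -EFinM [(g r * _)%R]mulrC.
have mpg : measurable_fun (`]0%R, +oo[%classic : set R) (fun r : R => (p r ^+ d * g r)%:E).
  apply/measurable_funTS/measurable_EFinP; apply: measurable_funM => //.
  exact: measurable_funX.
have pg0 r : `]0%R, +oo[%classic r -> 0 <= (p r ^+ d * g r)%:E.
  rewrite /= in_itv/= andbT => r0.
  by rewrite lee_fin mulr_ge0 ?exprn_ge0 ?g0// ltW// p0.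
(* For [r < 0] the sublevel set is empty. The null point [r = 0] is dropped too, because
   [lebesgue_vec_ball] asks for a positive radius. *)
rewrite integral_nonneg_half_line; last 2 first.
- apply: (eq_measurable_fun (fun r => (p r ^+ d * g r)%:E * ball_volume d)).
    by move=> r; rewrite inE/= in_itv/= andbT => r0; rewrite inner.
  by apply: emeasurable_funM.
- move=> r r0; rewrite (_ : mkset _ = set0) ?integral_set0//.
  apply/seteqP; split=> // x /= qr.
  by have := le_lt_trans (le_trans (q0 _ (enorm_ge0 x)) qr) r0; rewrite ltxx.
rewrite muleC -ge0_integralZr//.
by apply: eq_integral => r; rewrite inE/= in_itv/= andbT => r0; rewrite inner.
Qed.

Definition half_gauss_moment k : \bar R :=
  \int[mu]_(r in `]0%R, +oo[) (r ^+ k * half_gauss r)%:E.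

Lemma integral_tails_enorm_id d k :
  \int[lebesgue_vec R d]_x \int[mu]_(r in `[enorm x, +oo[) (r ^+ k * half_gauss r)%:E =
  ball_volume d * half_gauss_moment (d + k).
Proof.
rewrite (@integral_tails_enorm d id id (fun r => r ^+ k * half_gauss r)%R)//.
- congr (_ * _); apply: eq_integral => r _; congr EFin.
  by rewrite mulrA -exprD.
- exact: measurable_monomial_half_gauss.
- by move=> r r0; rewrite mulr_ge0 ?exprn_ge0 ?half_gauss_ge0.
Qed.

(** The constant common to all integrals sliced by balls; it is only ever compared with its
    reciprocals. *)
Definition gauss_ball d : \bar R := (normal_peak (1 : R) ^+ d)%:E * ball_volume d.

Lemma normal_vec_pdfE d (x : vec R d) :
  normal_vec_pdf x = (normal_peak 1 ^+ d * half_gauss (enorm x))%R.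
Proof. by []. Qed.

Lemma normal_peakX_ge0 d : 0 <= (normal_peak (1 : R) ^+ d)%:E.
Proof. by rewrite lee_fin exprn_ge0// normal_peak_ge0. Qed.

Lemma measurable_half_gauss_enorm d :
  measurable_fun setT (fun x : vec R d => (half_gauss (enorm x))%:E).
Proof.
apply/measurable_EFinP; apply: (measurableT_comp (f := @half_gauss R)).
  exact: measurable_half_gauss.
exact: measurable_enorm.
Qed.

Lemma integral_half_gauss_enorm d :
  (normal_peak (1 : R) ^+ d)%:E *
    \int[lebesgue_vec R d]_x (half_gauss (enorm x))%:E = 1.
Proof.
rewrite -ge0_integralZl//; last 3 first.
- exact: measurable_half_gauss_enorm.
- by move=> x _; rewrite lee_fin half_gauss_ge0.
- exact: normal_peakX_ge0.
transitivity (\int[std_normal_vec R d]_x cst 1 x); last first.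
  rewrite integral_cst// mul1e.
  exact: std_normal_vecT.
rewrite integral_std_normal_vec//.
by apply: eq_integral => x _; rewrite mul1e.
Qed.

(** The total mass of the Gaussian law, with [half_gauss s] written as the tail integral of
    [r * half_gauss r]: the ball of radius [r] contributes [r ^ d], the integrand one more factor
    [r]. *)
Lemma gauss_ball_moment d : gauss_ball d * half_gauss_moment d.+1 = 1.
Proof.
rewrite /gauss_ball -muleA -addn1 -integral_tails_enorm_id.
rewrite -[RHS](integral_half_gauss_enorm d); congr (_ * _).
apply: eq_integral => x _; rewrite -(integral_half_gauss_tail (enorm_ge0 x)).
by apply: eq_integral => r _; rewrite expr1.
Qed.

(** The same total mass, with [exp (- q)] as the tail of [exp (- r)] at [q = |x|^2 / 2]; the set
    [q <= r] is the ball of radius [sqrt (2 r)]. *)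
Lemma gauss_ball_Gamma d :
  gauss_ball d * \int[mu]_(r in `]0%R, +oo[) (Num.sqrt (r *+ 2) ^+ d * expR (- r))%:E = 1.
Proof.
rewrite /gauss_ball -muleA.
rewrite -(@integral_tails_enorm d (fun s => s ^+ 2 / 2)%R
  (fun r => Num.sqrt (r *+ 2)) (fun r => expR (- r)))//.
- rewrite -[RHS](integral_half_gauss_enorm d); congr (_ * _).
  by apply: eq_integral => x _; rewrite integral_expRN_tail.
- by apply: measurable_funM.
- by apply: measurableT_comp.
- move=> s r s0 r0; rewrite ler_pdivrMr// mulr_natr.
  by rewrite -[in RHS](ger0_norm s0) -sqrtr_sqr ler_sqrt// pmulrn_lge0.
- by move=> s s0; rewrite divr_ge0 ?sqr_ge0.
- by move=> r r0; rewrite sqrtr_gt0 pmulrn_lgt0.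
- apply: (measurableT_comp (f := @Num.sqrt R)).
    by apply: continuous_measurable_fun; exact: sqrt_continuous.
  under eq_fun do rewrite mulr2n.
  exact: measurable_funD.
Qed.

(** The mean norm is the integrated boundary term of [integral_half_gauss_tailS] at [k = 0] and
    [s = |x|]; the two tails on either side of it become moments. *)
Lemma enorm_expectationE d :
  gauss_ball d * half_gauss_moment d.+2 =
  enorm_expectation R d + gauss_ball d * half_gauss_moment d.
Proof.
have -> : enorm_expectation R d = (normal_peak (1 : R) ^+ d)%:E *
    \int[lebesgue_vec R d]_x (enorm x * half_gauss (enorm x))%:E.
  rewrite /enorm_expectation integral_std_normal_vec//; last 2 first.
  - by apply/measurable_EFinP; exact: measurable_enorm.
  - by move=> x; rewrite lee_fin enorm_ge0.
  rewrite -ge0_integralZl//.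
  - by apply: eq_integral => x _; rewrite normal_vec_pdfE -!EFinM mulrCA.
  - apply/measurable_EFinP; apply: measurable_funM; first exact: measurable_enorm.
    by apply/measurable_EFinP; exact: measurable_half_gauss_enorm.
  - by move=> x _; rewrite lee_fin mulr_ge0 ?enorm_ge0 ?half_gauss_ge0.
  - exact: normal_peakX_ge0.
rewrite /gauss_ball -!muleA -addn2 -integral_tails_enorm_id.
have -> : \int[lebesgue_vec R d]_x \int[mu]_(r in `[enorm x, +oo[) (r ^+ 2 * half_gauss r)%:E =
    \int[lebesgue_vec R d]_x (enorm x * half_gauss (enorm x))%:E +
    \int[lebesgue_vec R d]_x \int[mu]_(r in `[enorm x, +oo[) (r ^+ 0 * half_gauss r)%:E.
  rewrite -ge0_integralD//=.
  - by apply: eq_integral => x _; rewrite integral_half_gauss_tailS ?enorm_ge0// expr1 mul1e.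
  - by move=> x _; rewrite lee_fin mulr_ge0 ?enorm_ge0 ?half_gauss_ge0.
  - apply/measurable_EFinP; apply: measurable_funM; first exact: measurable_enorm.
    by apply/measurable_EFinP; exact: measurable_half_gauss_enorm.
  - move=> x _; apply: integral_ge0 => r _.
    by rewrite expr0 mul1r lee_fin half_gauss_ge0.
  - under eq_fun do under eq_integral do rewrite -[(_ ^+ 0 * _)%R]mul1r.
    apply: (@measurable_tail_integral _ (vec R d) R (@enorm R d) (fun=> 1%R)) => //.
    + exact: measurable_enorm.
    + exact: measurable_monomial_half_gauss.
    + by move=> x r _; rewrite mul1r expr0 mul1r half_gauss_ge0.
rewrite ge0_muleDr//.
- by rewrite integral_tails_enorm_id addn0.
- apply: integral_ge0 => x _.
  by rewrite lee_fin mulr_ge0 ?enorm_ge0 ?half_gauss_ge0.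
- by apply: integral_ge0 => x _; apply: integral_ge0 => r _; rewrite expr0 mul1r lee_fin half_gauss_ge0.
Qed.

(** Integration by parts from [s = 0], where the boundary term vanishes. *)
Lemma half_gauss_momentSS k :
  half_gauss_moment k.+2 = k.+1%:R%:E * half_gauss_moment k.
Proof.
have mm j : measurable_fun (`]0%R, +oo[%classic : set R) (fun r : R => (r ^+ j * half_gauss r)%:E).
  by apply/measurable_funTS/measurable_EFinP; exact: measurable_monomial_half_gauss.
rewrite /half_gauss_moment !integral_itv_obnd_cbnd//.
by rewrite integral_half_gauss_tailS// expr0n mul0r add0e.
Qed.

End enorm_moments.

(** * Joint law and conclusion *)

Section joint_law.
Context (R : realType) (dT dS : measure_display).
Context (T : measurableType dT) (S : measurableType dS).
Local Open Scope ereal_scope.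

Definition boxes (n : nat) : set (set (n.-tuple S)) :=
  [set B | exists A : 'I_n -> set S,
    (forall i, measurable (A i)) /\ B = [set t | forall i, A i (tnth t i)]].
Arguments boxes : clear implicits.

Lemma measurable_box n (A : 'I_n -> set S) : (forall i, measurable (A i)) ->
  measurable [set t : n.-tuple S | forall i, A i (tnth t i)].
Proof.
move=> mA; rewrite (_ : mkset _ = \bigcap_(i in [set: 'I_n])
  ((@tnth n S ^~ i) @^-1` A i)).
  apply: fin_bigcap_measurable => [|i _]; first exact: finite_finset.
  by rewrite -[X in measurable X]setTI; exact: measurable_tnth.
by apply/seteqP; split => [t /= h i _|t h i]; exact: h.
Qed.

Lemma measurable_boxes n : @measurable _ (n.-tuple S) = <<s boxes n >>.
Proof.
apply/seteqP; split.
  apply: smallest_sub; first exact: smallest_sigma_algebra.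
  case: n => [|n]; first by rewrite big_ord0.
  rewrite -bigcup_mkord_ord => _ [i _ [A mA <-]].
  apply: sub_sigma_algebra.
  (* A generator constrains one coordinate, so it is a box with all other sides full. *)
  exists (fun j => if j == inord i then A else setT); split=> [j|].
    by case: ifP => // _; exact: measurableT.
  rewrite setTI; apply/seteqP; split=> t /= => [At j|/(_ (inord i))].
    by case: eqP => // ->.
  by rewrite eqxx.
apply: smallest_sub; first exact: sigma_algebra_measurable.
by move=> _ [A [mA ->]]; exact: measurable_box.
Qed.

Lemma setI_closed_boxes n : setI_closed (boxes n).
Proof.
move=> _ _ [A [mA ->]] [B [mB ->]]; exists (fun i => A i `&` B i); split.
  by move=> i; exact: measurableI.
apply/seteqP; split=> t /= => [[At Bt] i|ABt]; first by split.
by split=> i; have [] := ABt i.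
Qed.

Variables (P : probability T R) (n : nat) (X : 'I_n -> {RV P >-> S}).
Variable m : {sigma_finite_measure set S -> \bar R}.

(** Independence over the full index set gives the product formula on boxes; boxes form a generating
    pi-system, on which finite measures are determined. *)
Lemma joint_law :
  mutually_independent X ->
  (forall i A, measurable A -> distribution P (X i) A = m A) ->
  forall A, measurable A ->
    P ((fun w => [tuple X i w | i < n]) @^-1` A) = power_measure m n A.
Proof.
move=> indX Xm A mA.
have mW : measurable_fun setT (fun w => [tuple X i w | i < n]).
  exact: (measurable_mktuple (F := fun i w => X i w)).
have boxT : boxes n [set: n.-tuple S].
  by exists (fun=> setT); split=> [//|]; apply/seteqP; split.
have PW A' : boxes n A' -> P ((fun w => [tuple X i w | i < n]) @^-1` A') = power_measure m n A'.
  move=> [B [mB ->]]; rewrite power_measure_box//.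
  have := indX [set: 'I_n]%SET B mB.
  rewrite (eq_bigl xpredT); last by move=> i; rewrite finset.in_setT.
  rewrite (eq_bigr (fun i => m (B i))); last by move=> i _; exact: Xm.
  move=> <-; congr (P _); apply/seteqP; split=> w /= h i; last first.
    by rewrite tnth_mktuple; apply: h; rewrite /= finset.in_setT.
  by move=> _; have := h i; rewrite tnth_mktuple.
apply: (@measure_unique _ R _ (boxes n) (fun=> setT) (measurable_boxes n)
  (@setI_closed_boxes n) (fun=> boxT) _
  (pushforward P (fun w => [tuple X i w | i < n])) (power_measure m n)) => //.
  by rewrite bigcup_const.
have PT : P ((fun w => [tuple X i w | i < n]) @^-1` setT) < +oo.
  by rewrite preimage_setT probability_setT ltry.
by move=> _; exact: PT.
Qed.

End joint_law.

(** * Finiteness, telescoping and the Gamma function *)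

Section closed_form.
Context (R : realType).
Local Open Scope ereal_scope.
Notation mu := (@lebesgue_measure R).

(** The source of finiteness: an infinite factor would make the product [+oo], or 0 by the
    convention on [0 * +oo], never 1. *)
Lemma mule_eq1 (x y : \bar R) : 0 <= x -> 0 <= y -> x * y = 1 ->
  exists2 r : R, (0 < r)%R & x = r^-1%:E /\ y = r%:E.
Proof.
move: x y => [x| |] [y| |] //.
- rewrite !lee_fin => x0 y0 -[xy].
  have yn0 : (y != 0)%R.
    by apply/eqP => y0'; move: xy => /eqP; rewrite y0' mulr0 eq_sym oner_eq0.
  exists y; first by rewrite lt_neqAle eq_sym yn0.
  by split=> //; congr EFin; rewrite -[LHS]mulr1 -(divff yn0) mulrA xy mul1r.
- rewrite lee_fin le_eqVlt => /predU1P[<-|x0] _.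
    by rewrite mul0e => /eqP; rewrite eq_sym onee_eq0.
  by rewrite gt0_muley.
- rewrite lee_fin => _; rewrite le_eqVlt => /predU1P[<-|x0].
    by rewrite mule0 => /eqP; rewrite eq_sym onee_eq0.
  by rewrite gt0_mulye.
Qed.

Lemma gauss_ball_ge0 d : 0 <= gauss_ball R d.
Proof. by rewrite mule_ge0// normal_peakX_ge0. Qed.

Lemma half_gauss_moment_ge0 k : 0 <= half_gauss_moment R k.
Proof.
apply: integral_ge0 => r; rewrite /= in_itv/= andbT => r0.
by rewrite lee_fin mulr_ge0 ?exprn_ge0 ?half_gauss_ge0// ltW.
Qed.

(* Index shift: [moment d] is the moment of order [d.+1], the one dual to
   [gauss_ball d]. *)
Definition moment d : R := fine (half_gauss_moment R d.+1).

Lemma momentP d : (0 < moment d)%R /\ half_gauss_moment R d.+1 = (moment d)%:E /\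
  gauss_ball R d = (moment d)^-1%:E.
Proof.
have [r r0 [KE IE]] := mule_eq1 (gauss_ball_ge0 d) (half_gauss_moment_ge0 _)
  (gauss_ball_moment R d).
by rewrite /moment IE.
Qed.

Lemma enorm_expectation_moment d :
  enorm_expectation R d.+1 = (d.+1%:R * moment d / moment d.+1)%:E.
Proof.
have [i0 [IE _]] := momentP d; have [j0 [JE KE]] := momentP d.+1.
have := enorm_expectationE R d.+1.
rewrite half_gauss_momentSS IE KE.
have : 0 <= enorm_expectation R d.+1.
  by apply: integral_ge0 => x _; rewrite lee_fin enorm_ge0.
case: (enorm_expectation R d.+1) => [m| |] // _.
rewrite -!EFinM -EFinD => -[h]; congr EFin.
(* The factor [d.+2] from the moment recursion loses 1 to the term added to the mean, which leaves
   [d.+1]. *)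
apply/eqP; rewrite -(inj_eq (addIr ((moment d.+1)^-1 * moment d)%R)) -h; apply/eqP.
by rewrite -(natr1 d.+1); field; rewrite gt_eqF.
Qed.

Lemma moment0 : moment 0 = 1%R.
Proof.
rewrite /moment /half_gauss_moment integral_itv_obnd_cbnd; last first.
  by apply/measurable_funTS/measurable_EFinP; exact: measurable_monomial_half_gauss.
under eq_integral do rewrite expr1.
by rewrite integral_half_gauss_tail//= /half_gauss expr0n/= mul0r oppr0 expR0.
Qed.

(** Induction on the number of vectors. The means telescope to [d! / moment d], and [n ^_ d] is
    [binomial (n, d)] times [d!]; for [n < d] it is 0, in accordance with a flat zonotope. *)
Lemma zon_expectationE d n :
  zon_expectation R d n = ((n ^_ d)%:R / moment d)%:E.
Proof.
elim: n d => [|n IH] [|d].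
- by rewrite zon_expectation0n moment0 ffactn0 divr1.
- by rewrite zon_expectationS0 ffact0n mul0r.
- by rewrite zon_expectation0n moment0 ffactn0 divr1.
have [i0 _] := momentP d; have [j0 _] := momentP d.+1.
rewrite zon_expectationSS !IH enorm_expectation_moment -EFinM -EFinD; congr EFin.
have [dn|nd] := leqP d n; last first.
  by rewrite !ffact_small ?ltnS ?(ltnW nd)//; rewrite !mul0r mulr0 addr0.
(* Pascal's rule multiplied by [(d + 1)!]; [d <= n] keeps the truncated [n - d] exact. *)
have -> : ((n.+1 ^_ d.+1)%:R = (n ^_ d.+1)%:R + d.+1%:R * (n ^_ d)%:R :> R)%R.
  rewrite -natrM -natrD; congr (_%:R)%R.
  by rewrite ffactSS ffactnSr [(_ * (n - d))%N]mulnC -mulnDl; congr muln; rewrite addnS subnK.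
by field; rewrite !gt_eqF.
Qed.

(** Both sides are reciprocals of [gauss_ball d]. *)
Lemma Gamma_moment d : (2 `^ (d%:R / 2) * Gamma (d%:R / 2 + 1))%R = moment d.
Proof.
have [i0 [_ KE]] := momentP d.
have := gauss_ball_Gamma R d.
set J := \int[mu]_(r in _) _; rewrite KE => KJ.
have JE : J = (moment d)%:E.
  have J0 : 0 <= J.
    apply: integral_ge0 => r _; rewrite lee_fin; apply: mulr_ge0.
      exact: exprn_ge0.
    exact: expR_ge0.
  have i0' : 0 <= (moment d)^-1%:E by rewrite lee_fin invr_ge0 ltW.
  by have [r r0 [[/invr_inj ->] ->]] := mule_eq1 i0' J0 KJ.
pose G := \int[mu]_(x in `]0%R, +oo[) (x `^ (d%:R / 2) * expR (- x))%:E.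
(* Pointwise, [sqrt (2 r) ^ d] is [2 ^ (d / 2) * r ^ (d / 2)]. *)
have JG : J = (2 `^ (d%:R / 2))%:E * G.
  rewrite -ge0_integralZl//.
  - apply: eq_integral => r; rewrite inE/= in_itv/= andbT => r0.
    rewrite -EFinM mulrA -powRM ?ltW//; congr (_ * _)%:E.
    rewrite -(mulr_natl r 2) -powR12_sqrt; last by rewrite mulr_ge0// ltW.
    by rewrite -powR_mulrn ?powR_ge0// -powRrM [(_^-1 * _)%R]mulrC.
  - apply/measurable_funTS/measurable_EFinP; apply: measurable_funM.
      exact: measurable_powR.
    exact: measurableT_comp.
  - by move=> r _; rewrite lee_fin mulr_ge0 ?powR_ge0 ?expR_ge0.
rewrite /Gamma /Rintegral addrK -/G.
have p0 : (0 < 2 `^ (d%:R / 2) :> R)%R by exact: powR_gt0.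
(* [Gamma] is the real part of [G] and would be a default 0 if [G] were infinite; finiteness of [J]
   excludes this. *)
move: JG; rewrite JE; case: G => [g| |].
- by rewrite -EFinM => -[].
- by rewrite gt0_muley.
- by rewrite gt0_muleNy.
Qed.

End closed_form.

Theorem mainTheorem5 (R : realType) (dT : measure_display)
    (T : measurableType dT) (P : probability T R) (d n : nat)
    (X : 'I_n -> {RV P >-> vec R d}) :
  (1 <= d)%N -> (d <= n)%N ->
  mutually_independent X ->
  (forall (i : 'I_n) (A : set (vec R d)), measurable A ->
    distribution P (X i) A = std_normal_vec R d A) ->
  (\int[P]_w lebesgue_vec R d (Zon (fun i => X i w)) =
    (n`!%:R / (2 `^ (d%:R / 2) * (n - d)`!%:R * Gamma (d%:R / 2 + 1)))%:E)%E.
Proof.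
move=> _ dn indX Xm.
(* The volume depends on [w] through the tuple of the [X i] alone, whose law is the product
   measure. *)
transitivity (zon_expectation R d n).
  rewrite /zon_expectation -(@ge0_integral_transfer _ _ _ _ R P
    (power_measure (std_normal_vec R d) n) (fun w => [tuple X i w | i < n])
    (fun xs => lebesgue_vec R d (Zon (tnth xs))))//.
  - apply: eq_integral => w _; congr (lebesgue_vec R d (Zon _)).
    by apply/funext => i; rewrite tnth_mktuple.
  - exact: (measurable_mktuple (F := fun i w => X i w)).
  - exact: joint_law.
  - exact: measurable_lebesgue_Zon.
rewrite zon_expectationE; congr EFin.
have [i0 _] := momentP R d.
(* The power of 2 and the Gamma value merge into [moment d], and [n!] splits as [n ^_ d] times
   [(n - d)!]. *)
rewrite mulrAC Gamma_moment -(ffact_fact dn) natrM.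
have f0 : (n - d)`!%:R != 0 :> R by rewrite pnatr_eq0 -lt0n fact_gt0.
by field; rewrite f0 gt_eqF.
Qed.
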